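(* Let $K$ be a non-empty compact Hausdorff space and let $A$ be a closed, densely defined and real operator on $E=C(K)$. Suppose that $\lambda_0\in\mathbb{R}$ is an eigenvalue of $A$ and a pole of the resolvent $R(\cdot,A)$. Let $P$ be the corresponding spectral projection. Then the following assertions are equivalent: (i) $P\gg 0$. (ii) The resolvent $R(\cdot,A)$ is individually eventually strongly positive at $\lambda_0$. If $\lambda_0=s(A)$, then (i) and (ii) are also equivalent to the following assertions: (iii) For every $\lambda>s(A)$ and every $f>0$ there exists $n_0\in\mathbb{N}$ such that $R(\lambda,A)^nf\gg 0$ for all $n\ge n_0$. (iv) There exists $\lambda>s(A)$ such that for every $f>0$ there exists $n_0\in\mathbb{N}$ such that $R(\lambda,A)^nf\gg 0$ for all $n\ge n_0$.
   Context: $C(K)$ is the space of complex-valued continuous functions on $K$ with the supremum norm. For $f\in C(K)$: $f\ge 0$ means $f(x)\ge 0$ for all $x\in K$; $f>0$ means $f\ge 0$ and $f\ne 0$; $f\gg 0$ means there is $\beta>0$ with $f\ge\beta\mathbf{1}$. A bounded operator $T$ on $C(K)$ satisfies $T\gg 0$ if $Tf\gg 0$ for all $f>0$. An operator $A$ on $C(K)$ is real if $x+iy\in D(A)$ with $x,y$ real-valued implies $x,y\in D(A)$, and $A$ maps real-valued functions in $D(A)$ to real-valued functions. $R(\lambda,A)=(\lambda I-A)^{-1}$ for $\lambda\in\rho(A)$ and $s(A)=\sup\{\operatorname{Re}\lambda:\lambda\in\sigma(A)\}$. The spectral projection associated with an isolated spectral value $\lambda_0$ is the residue of $R(\cdot,A)$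 at $\lambda_0$. The resolvent $R(\cdot,A)$ is individually eventually strongly positive at a real spectral value $\lambda_0$ if there is $\lambda_2>\lambda_0$ such that $(\lambda_0,\lambda_2]\subseteq\rho(A)$ and for each $f>0$ there is $\lambda_1\in(\lambda_0,\lambda_2]$ with $R(\lambda,A)f\gg 0$ for all $\lambda\in(\lambda_0,\lambda_1]$. *)

(* Defs.v *)
(* Complex numbers are R[i] over R : realType, seen as the normed field R[i]^o
   wherever a topology is needed. *)
From HB Require Import structures.
From mathcomp Require Import all_boot all_order all_algebra.
From mathcomp Require Import all_classical all_reals.
From mathcomp Require Import topology ereal normedtype sequences.
From mathcomp Require Import complex.
Set Implicit Arguments.
Unset Strict Implicit.
Unset Printing Implicit Defensive.
Import Order.TTheory GRing.Theory Num.Theory.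
Import numFieldNormedType.Exports.
Local Open Scope classical_set_scope.
Local Open Scope ring_scope.
Local Open Scope complex_scope.

(* The type depends on the compactness proof because compactness is what makes
   the supremum norm finite. *)
Definition Cspace (R : realType) (K : topologicalType)
  (cK : compact [set: K]) : Type := continuousType K R[i]^o.

Section Cspace_normedModule.
Variables (R : realType) (K : topologicalType) (cK : compact [set: K]).
Local Notation E := (Cspace R cK).


Definition mkC (f : K -> R[i]^o) (cf : continuous f) : E :=
  (mkcts cf : continuousType K R[i]^o).

Lemma Ccts (f : E) : continuous (f : K -> R[i]^o).
Proof. exact: (@cts_fun _ _ f). Qed.

Lemma CspaceP (f g : E) : f = g <-> (forall x, f x = g x).
Proof. exact: (continuousEP f g). Qed.

HB.instance Definition _ := gen_eqMixin E.
HB.instance Definition _ := gen_choiceMixin E.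

Definition Czero : E := mkC (fun x => cvg_cst (0 : R[i]^o)).
Definition Copp (f : E) : E := mkC (fun x => cvgN (@Ccts f x)).
Definition Cadd (f g : E) : E :=
  mkC (fun x => cvgD (@Ccts f x) (@Ccts g x)).
Definition Cscale (a : R[i]) (f : E) : E :=
  mkC (fun x => @cvgZl_tmp _ R[i]^o _ _ _ a _ _ (@Ccts f x)).

Fact CaddA : associative Cadd.
Proof. by move=> f g h; apply/CspaceP => x; exact: addrA. Qed.
Fact CaddC : commutative Cadd.
Proof. by move=> f g; apply/CspaceP => x; exact: addrC. Qed.
Fact Cadd0 : left_id Czero Cadd.
Proof. by move=> f; apply/CspaceP => x; exact: add0r. Qed.
Fact CaddN : left_inverse Czero Copp Cadd.
Proof. by move=> f; apply/CspaceP => x; exact: addNr. Qed.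
HB.instance Definition _ := GRing.isZmodule.Build E CaddA CaddC Cadd0 CaddN.

Fact CscaleA a b f : Cscale a (Cscale b f) = Cscale (a * b) f.
Proof. by apply/CspaceP => x; exact: mulrA. Qed.
Fact Cscale1 : left_id 1 Cscale.
Proof. by move=> f; apply/CspaceP => x; exact: mul1r. Qed.
Fact CscaleDr : right_distributive Cscale +%R.
Proof. by move=> a f g; apply/CspaceP => x; exact: mulrDr. Qed.
Fact CscaleDl f : {morph Cscale^~ f : a b / a + b}.
Proof. by move=> a b; apply/CspaceP => x; exact: mulrDl. Qed.
HB.instance Definition _ :=
  GRing.Zmodule_isLmodule.Build R[i] E CscaleA Cscale1 CscaleDr CscaleDl.

Lemma CzeroE x : (0 : E) x = 0. Proof. by []. Qed.
Lemma CaddE (f g : E) x : (f + g) x = f x + g x. Proof. by []. Qed.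
Lemma CscaleE a (f : E) x : (a *: f) x = a * f x. Proof. by []. Qed.

Definition supnorm (f : E) : R :=
  sup [set ComplexField.Normc.normc (f x) | x in [set: K]].

(* A norm on an R[i]-module takes its values in R[i] in MathComp. *)
Definition Cnorm (f : E) : R[i] := (supnorm f)%:C.

Local Notation normc := ComplexField.Normc.normc.

Lemma normcE (z : R[i]) : `|z| = (normc z)%:C.
Proof. by []. Qed.

Lemma normc_ge0 (z : R[i]) : 0 <= normc z.
Proof. by case: z => a b; exact: sqrtr_ge0. Qed.

Lemma normc_leD (z w : R[i]) : normc (z + w) <= normc z + normc w.
Proof. by rewrite -lecR rmorphD /= -!normcE ler_normD. Qed.

Lemma normc_dist (z w : R[i]) : `|normc z - normc w| <= normc (z - w).
Proof.
have normcC (a b : R[i]) : normc (a - b) = normc (b - a).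
  by have := distrC a b; rewrite !normcE => -[].
have le_dist (a b : R[i]) : normc a - normc b <= normc (a - b).
  by have := normc_leD (a - b) b; rewrite subrK lerBlDr.
by rewrite ler_norml lerNl opprB le_dist andbT normcC le_dist.
Qed.

Lemma supnorm_has_ubound (f : E) : has_ubound [set normc (f x) | x in [set: K]].
Proof.
have normc_cts : continuous (fun x : K => normc (f x) : R).
  move=> x; apply/cvgrPdist_lt => e e0.
  have e0' : (0 : R[i]) < e%:C by rewrite ltcR.
  have fx := @cvgr_dist_lt _ R[i]^o _ _ _ _ _ (@Ccts f x) _ e0'.
  near=> y; apply: le_lt_trans (normc_dist _ _) _.
  by rewrite -ltcR -normcE; near: y; exact: fx.
have /compact_bounded[M [_ MP]] :
    compact ((fun x : K => normc (f x) : R) @` [set: K]).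
  by apply: continuous_compact => //; exact: continuous_subspaceT.
exists (M + 1) => _ [x _ <-].
by apply: le_trans (ler_norm _) _; apply: (MP (M + 1)); [rewrite ltrDl|exists x].
Unshelve. all: by end_near. Qed.

Lemma supnorm_ubound (f : E) x : normc (f x) <= supnorm f.
Proof. by apply: ub_le_sup; [exact: supnorm_has_ubound|exists x]. Qed.

Lemma supnorm_lub (f : E) (c : R) : 0 <= c ->
  (forall x, normc (f x) <= c) -> supnorm f <= c.
Proof.
move=> c0 fc; have [S0|/set0P S0] :=
    eqVneq [set normc (f x) | x in [set: K]] set0.
  by rewrite /supnorm S0 sup0.
by apply: ge_sup => // _ [x _ <-].
Qed.

Lemma supnorm_ge0 (f : E) : 0 <= supnorm f.
Proof.
have [S0|/set0P[_ [x _ _]]] := eqVneq [set normc (f x) | x in [set: K]] set0.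
  by rewrite /supnorm S0 sup0.
exact: le_trans (normc_ge0 (f x)) (supnorm_ubound f x).
Qed.

Fact CnormD f g : Cnorm (f + g) <= Cnorm f + Cnorm g.
Proof.
rewrite -rmorphD /= lecR; apply: supnorm_lub => [|x].
  by rewrite addr_ge0 ?supnorm_ge0.
rewrite CaddE; apply: le_trans (normc_leD _ _) _.
by rewrite lerD ?supnorm_ubound.
Qed.

Fact CnormZ (a : R[i]) f : Cnorm (a *: f) = `|a| * Cnorm f.
Proof.
rewrite normcE -rmorphM /=; congr (_%:C).
have le_scale (b : R[i]) g : supnorm (b *: g) <= normc b * supnorm g.
  apply: supnorm_lub => [|x]; first by rewrite mulr_ge0 ?normc_ge0 ?supnorm_ge0.
  rewrite CscaleE ComplexField.Normc.normcM.
  by rewrite ler_wpM2l ?normc_ge0 ?supnorm_ubound.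
apply/eqP; rewrite eq_le le_scale /=; have [->|a0] := eqVneq a 0.
  by rewrite ComplexField.Normc.normc0 mul0r supnorm_ge0.
have na0 : 0 < normc a by rewrite -ltcR -normcE normr_gt0.
rewrite -ler_pdivlMl // -ComplexField.Normc.normcV.
by rewrite -{1}[f]scale1r -(mulVf a0) -scalerA le_scale.
Qed.

Fact Cnorm0_eq0 f : Cnorm f = 0 -> f = 0.
Proof.
move=> [f0]; apply/CspaceP => x; rewrite CzeroE.
apply: ComplexField.Normc.eq0_normc; apply/eqP.
by rewrite eq_le normc_ge0 andbT -f0 supnorm_ubound.
Qed.

HB.instance Definition _ :=
  @Lmodule_isNormed.Build R[i] E Cnorm CnormD CnormZ Cnorm0_eq0.

End Cspace_normedModule.

Section operators.
Variables (R : realType) (E : normedModType R[i]).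

Definition bounded_operator (T : E -> E) : Prop :=
  linear T /\ exists M : R[i], forall f, `|T f| <= M * `|f|.

(* The values of op outside dom are irrelevant. *)
Record operator : Type := Operator {
  dom : set E;
  op :> E -> E;
  dom0 : dom 0;
  dom_lin : forall a u v, dom u -> dom v -> dom (a *: u + v);
  op_lin : forall a u v, dom u -> dom v -> op (a *: u + v) = a *: op u + op v
}.

Definition closed_operator (A : operator) : Prop :=
  closed [set p : E * E | dom A p.1 /\ p.2 = A p.1].

Definition densely_defined (A : operator) : Prop := dense (dom A).

(* T is the bounded inverse of l I - A : dom A -> E. *)
Definition is_resolvent (A : operator) (l : R[i]) (T : E -> E) : Prop :=
  [/\ bounded_operator T,
      forall f, dom A (T f) /\ l *: T f - A (T f) = f &
      forall u, dom A u -> T (l *: u - A u) = u].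

Definition resolvent_set (A : operator) : set R[i] :=
  [set l | exists T, is_resolvent A l T].

Definition spectrum (A : operator) : set R[i] := ~` resolvent_set A.

Definition resolvent (A : operator) (l : R[i]) : E -> E :=
  xget (fun=> 0) (is_resolvent A l).

Definition spectral_bound (A : operator) : \bar R :=
  ereal_sup [set (complex.Re l)%:E | l in spectrum A].

Definition is_eigenvalue (A : operator) (l : R[i]) : Prop :=
  exists u, [/\ dom A u, u <> 0 & A u = l *: u].

(* Uniform convergence on the unit ball is convergence in operator norm. *)
Definition opnorm_cvg (S : nat -> E -> E) (T : E -> E) : Prop :=
  {uniform [set f : E | `|f| <= 1], S @ \oo --> T}.

(* F(z) = \sum_(k in Z) (z - z0)^k U_k on a punctured neighbourhood of z0 on
   which F is defined (O is the domain of F); the two one-sided series converge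
   separately. *)
Definition laurent_expansion (O : set R[i]) (F : R[i] -> E -> E) (z0 : R[i])
    (U : int -> E -> E) : Prop :=
  (forall k, bounded_operator (U k)) /\
  \forall z \near (z0 : R[i]^o)^', O z /\
    exists G H : E -> E,
      [/\ opnorm_cvg (series (fun n : nat => (z - z0) ^ n%:Z *: U n%:Z)) G,
          opnorm_cvg (series (fun n : nat =>
            (z - z0) ^ (- n.+1%:Z) *: U (- n.+1%:Z))) H &
          F z = G + H].

Definition pole (O : set R[i]) (F : R[i] -> E -> E) (z0 : R[i]) : Prop :=
  exists U : int -> E -> E, laurent_expansion O F z0 U /\
    exists m : nat, [/\ (0 < m)%N, U (- m%:Z) <> 0 &
      forall k : nat, (m < k)%N -> U (- k%:Z) = 0].

Definition residue (O : set R[i]) (F : R[i] -> E -> E) (z0 : R[i])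
    (P : E -> E) : Prop :=
  exists U : int -> E -> E, laurent_expansion O F z0 U /\ U (- 1) = P.

Definition resolvent_pole (A : operator) (l : R[i]) : Prop :=
  pole (resolvent_set A) (resolvent A) l.

Definition spectral_projection (A : operator) (l : R[i]) (P : E -> E) : Prop :=
  spectrum A l /\ residue (resolvent_set A) (resolvent A) l P.

End operators.

Section positivity.
Variables (R : realType) (K : topologicalType) (cK : compact [set: K]).
Local Notation E := (Cspace R cK).

(* In R[i], a <= b means that b - a is real and nonnegative. *)
Definition nonneg (f : E) : Prop := forall x, 0 <= f x.

Definition positive (f : E) : Prop := nonneg f /\ f <> 0.

Definition strongly_positive (f : E) : Prop :=
  exists2 b : R, 0 < b & forall x, b%:C <= f x.

Definition strongly_positive_operator (T : E -> E) : Prop :=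
  forall f, positive f -> strongly_positive (T f).

Definition real_valued (f : E) : Prop := forall x, complex.Im (f x) = 0.

Definition real_operator (A : operator E) : Prop :=
  (forall u v : E, real_valued u -> real_valued v ->
     dom A (u + 'i%C *: v) -> dom A u /\ dom A v) /\
  (forall u : E, real_valued u -> dom A u -> real_valued (A u)).

Definition indiv_eventually_strongly_positive (A : operator E) (l0 : R) : Prop :=
  exists2 l2 : R, l0 < l2 &
    (forall l : R, l0 < l <= l2 -> resolvent_set A l%:C) /\
    (forall f : E, positive f ->
      exists2 l1 : R, l0 < l1 <= l2 &
        forall l : R, l0 < l <= l1 -> strongly_positive (resolvent A l%:C f)).

Definition powers_eventually_strongly_positive (A : operator E) (l : R) : Prop :=
  forall f : E, positive f ->
    exists n0 : nat, forall n : nat, (n0 <= n)%N ->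
      strongly_positive (iter n (resolvent A l%:C) f).

End positivity.

(* Main.v *)
(** Write R(l0 + h) = sum_k h^k U_k with U_k = 0 for k < -m. Comparing coefficients
    in the resolvent identity gives (A - l0) U_k = U_(k-1) - [k = 0], so P = U_(-1) is
    idempotent, fixes the eigenvectors, and U_(-m) maps into the eigenspace.

    If U_(-m) >= 0, positive eigenvectors are >> 0 and every f > 0 is carried by powers
    of the resolvent to a function >> 0, then U_(-m) f = u >> 0 for some f >= 0. For
    m >= 2 we would have U_(-m) u = 0, hence U_(-m) = 0 by domination; so m = 1 and
    P = U_(-m) >= 0. Finally P f is 0 or >> 0, and P f = 0 would give P u = 0. This
    yields (ii) => (i); in (iv) => (i) the positivity of U_(-m) comes from the Neumann
    series R(l0 + h) = sum_n t^n R(l)^(n+1), t = l - l0 - h, whose first terms are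
    killed by the factor h^m.

    Conversely P >> 0 forces P to have rank one, so the pole is simple. Then
    h R(l0 + h) f -> P f, which is (ii), and ((l - l0) R(l))^n f -> P f, which is (iii).
    The last limit and the Neumann series rest on an elementary form of the spectral
    radius formula: if 1 - z T is invertible for |z| <= d, then d^n T^n -> 0 in norm
    (averaging over roots of unity replaces contour integrals). *)
Require Import Defs.
From HB Require Import structures.
From mathcomp Require Import all_boot all_order all_algebra.
From mathcomp Require Import all_classical all_reals.
From mathcomp Require Import topology ereal normedtype sequences.
From mathcomp Require Import complex lra ring.
Set Implicit Arguments.
Unset Strict Implicit.
Unset Printing Implicit Defensive.
Import Order.TTheory GRing.Theory Num.Theory.
Import numFieldNormedType.Exports.
Local Open Scope classical_set_scope.
Local Open Scope ring_scope.
Local Open Scope complex_scope.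

(** * Real-valued norm and two-sided power series *)

Local Notation normc := ComplexField.Normc.normc.

Section real_norm.
Context {R : realType} {E : normedModType R[i]}.
Implicit Types f g : E.

(** The norm of a module over [R[i]] is [R[i]]-valued, and the order there is only partial; taking
    its real part permits ordinary real estimates. *)
Definition nrm (f : E) : R := complex.Re `|f|.

Lemma nrmE f : `|f| = (nrm f)%:C.
Proof.
have : 0 <= `|f| by exact: normr_ge0.
by rewrite /nrm lecE /=; case: `|f| => a b /= /andP[/eqP -> _].
Qed.

Lemma nrm_ge0 f : 0 <= nrm f.
Proof. by rewrite -ler0c -nrmE. Qed.

Lemma nrm0 : nrm 0 = 0.
Proof. by rewrite /nrm normr0. Qed.

Lemma nrm_eq0 f : nrm f = 0 -> f = 0.
Proof. by move=> f0; apply/normr0_eq0; rewrite nrmE f0. Qed.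

Lemma nrmN f : nrm (- f) = nrm f.
Proof. by rewrite /nrm normrN. Qed.

Lemma nrmD f g : nrm (f + g) <= nrm f + nrm g.
Proof. by rewrite -lecR rmorphD /= -!nrmE ler_normD. Qed.

Lemma nrmZ (a : R[i]) f : nrm (a *: f) = normc a * nrm f.
Proof. by apply: complexI; rewrite rmorphM /= -!nrmE -Defs.normcE normrZ. Qed.

Lemma nrm_distC f g : nrm (f - g) = nrm (g - f).
Proof. by rewrite -nrmN opprB. Qed.

Lemma nrm_sum (u : nat -> E) n : nrm (\sum_(0 <= k < n) u k) <= \sum_(0 <= k < n) nrm (u k).
Proof.
elim: n => [|n ih]; first by rewrite !big_geq // nrm0.
by rewrite !big_nat_recr //= (le_trans (nrmD _ _)) // lerD2r.
Qed.

Lemma cvg_nrmP (u : nat -> E) (l : E) : u @ \oo --> l <->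
  forall e : R, 0 < e -> \forall n \near \oo, nrm (l - u n) <= e.
Proof.
split=> [/cvgrPdist_le ul e e0|ul].
  have e0' : (0 : R[i]) < e%:C by rewrite ltcR.
  by apply: filterS (ul _ e0') => n; rewrite nrmE lecR.
apply/cvgrPdist_le => e e0.
move: (e0); rewrite ltcE /= => /andP[/eqP ei er].
by apply: filterS (ul _ er) => n; rewrite nrmE lecE /= ei eqxx.
Qed.

Lemma cvg_nrm_le (u : nat -> E) (l : E) (M : R) :
  u @ \oo --> l -> (forall n, nrm (u n) <= M) -> nrm l <= M.
Proof.
move=> /cvg_nrmP ul uM; apply/ler_addgt0Pl => e e0.
have [n _ /(_ n (leqnn n)) ne] := ul _ e0.
by rewrite -[l](subrK (u n)) (le_trans (nrmD _ _)) // lerD.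
Qed.

Lemma cvg_nrm_bounded (u : nat -> E) (l : E) :
  u @ \oo --> l -> exists M, forall n, nrm (u n) <= M.
Proof.
move=> /cvg_nrmP /(_ _ ltr01) [N _ uN].
have sum_ge0 m : 0 <= \sum_(0 <= k < m) nrm (u k).
  by apply: sumr_ge0 => k _; exact: nrm_ge0.
exists (\sum_(0 <= k < N) nrm (u k) + (nrm l + 1)) => n.
have [nN|nN] := leqP N n.
  apply: ler_wpDl => //; rewrite -[u n](subKr l) (le_trans (nrmD _ _)) // nrmN lerD2l.
  exact: uN.
apply: ler_wpDr; first by rewrite addr_ge0 ?nrm_ge0 ?ler01.
by rewrite big_mkord (bigD1 (Ordinal nN)) //= lerDl sumr_ge0 // => k _; exact: nrm_ge0.
Qed.

Lemma cvg_lin (T : E -> E) (c : R) (u : nat -> E) (l : E) : linear T ->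
  (forall f, nrm (T f) <= c * nrm f) -> u @ \oo --> l -> (T \o u) @ \oo --> T l.
Proof.
move=> Tl Tc /cvg_nrmP ul; apply/cvg_nrmP => e e0.
(* The sign of [c] is unknown, so it is replaced by a strictly positive bound before dividing. *)
have c0 : 0 < `|c| + 1 by rewrite ltr_wpDl.
apply: filterS (ul (e / (`|c| + 1)) (divr_gt0 e0 c0)) => n; rewrite ler_pdivlMr // => ne.
have -> : T l - (T \o u) n = T (l - u n).
  by rewrite /= addrC -scaleN1r -Tl scaleN1r addrC.
apply: le_trans (Tc _) (le_trans _ ne); rewrite mulrC ler_wpM2l ?nrm_ge0 //.
by rewrite (le_trans (ler_norm _)) // lerDl.
Qed.

End real_norm.

Section linear_maps.
Context {K : pzRingType} {V W : lmodType K} (T : V -> W) (Tl : linear T).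

Lemma lin0 : T 0 = 0.
Proof. by have := Tl (-1) 0 0; rewrite scaleN1r addNr scaleN1r addNr. Qed.
Lemma linD u v : T (u + v) = T u + T v.
Proof. by rewrite -[u]scale1r Tl !scale1r. Qed.
Lemma linZ a u : T (a *: u) = a *: T u.
Proof. by rewrite -[a *: u]addr0 Tl lin0 addr0. Qed.
Lemma linN u : T (- u) = - T u.
Proof. by rewrite -scaleN1r linZ scaleN1r. Qed.
Lemma linB u v : T (u - v) = T u - T v.
Proof. by rewrite linD linN. Qed.
Lemma lin_sum (u : nat -> V) n :
  T (\sum_(0 <= k < n) u k) = \sum_(0 <= k < n) T (u k).
Proof.
elim: n => [|n ih]; first by rewrite !big_geq // lin0.
by rewrite !big_nat_recr //= linD ih.
Qed.

End linear_maps.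

(** * Two-sided power series with vector coefficients *)

Section laurent_series.
Context {R : realType} {E : normedModType R[i]}.
Implicit Types (c d : int -> E) (h : R[i]) (v w : E).

Definition lsum c h v : Prop := exists a b,
  [/\ series (fun n => h ^+ n *: c n%:Z) @ \oo --> a,
      series (fun n => h ^- n.+1 *: c (Negz n)) @ \oo --> b & v = a + b].

Lemma lsum_lincomb c d h v w (a : R[i]) : lsum c h v -> lsum d h w ->
  lsum (fun k => a *: c k + d k) h (a *: v + w).
Proof.
have serE (s : nat -> R[i]) (p q : nat -> E) :
    series (fun n => s n *: (a *: p n + q n)) =
    a \*: series (fun n => s n *: p n) + series (fun n => s n *: q n).
  apply/funext => n; rewrite fctE /= /series /= scaler_sumr -big_split /=.
  by apply: eq_bigr => i _; rewrite scalerDr !scalerA mulrC.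
move=> [a1 [b1 [ca1 cb1 ->]]] [a2 [b2 [ca2 cb2 ->]]].
exists (a *: a1 + a2), (a *: b1 + b2); rewrite !serE; split.
- by apply: cvgD => //; exact: cvgZl_tmp.
- by apply: cvgD => //; exact: cvgZl_tmp.
- by rewrite scalerDr addrACA.
Qed.

Lemma lsum_lin c h v (T : E -> E) (b : R) : linear T ->
  (forall f, nrm (T f) <= b * nrm f) -> lsum c h v -> lsum (T \o c) h (T v).
Proof.
move=> Tl Tb; have serE (s : nat -> R[i]) (p : nat -> E) :
    series (fun n => s n *: T (p n)) = T \o series (fun n => s n *: p n).
  apply/funext => n; rewrite /series /= (lin_sum Tl).
  by apply: eq_bigr => i _; rewrite linZ.
move=> [a1 [b1 [ca1 cb1 ->]]]; exists (T a1), (T b1); rewrite !serE (linD Tl).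
by split=> //; exact: cvg_lin.
Qed.

Lemma lsum_const h v : lsum (fun k => if k == 0 then v else 0) h v.
Proof.
exists v, 0; split; last by rewrite addr0.
- rewrite -cvg_shiftS; apply: cvg_near_cst; near=> n; rewrite /series /=.
  rewrite big_nat_recl //= expr0 scale1r big1 ?addr0 // => i _.
  by rewrite scaler0.
- rewrite (_ : series _ = fun=> 0); first exact: cvg_cst.
  by apply/funext => n; rewrite /series /= big1 // => i _; rewrite scaler0.
Unshelve. all: by end_near. Qed.

Lemma lsum_shiftD c h v : h != 0 -> lsum c h v -> lsum (fun k => c (k - 1)) h (h *: v).
Proof.
(* Multiplication by [h] makes the term of index [-1] constant, so it passes from the negative half
   to the nonnegative half. *)
move=> h0 [a [b [ca cb ->]]]; exists (c (Negz 0) + h *: a), (h *: b - c (Negz 0)); split.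
- rewrite -cvg_shiftS /=.
  have -> : (fun n => series (fun n : nat => h ^+ n *: c (n%:Z - 1)) n.+1) =
      (fun n => c (Negz 0) + h *: series (fun n => h ^+ n *: c n%:Z) n).
    apply/funext => n; rewrite /series /= big_nat_recl //= expr0 scale1r.
    congr (_ + _); rewrite scaler_sumr; apply: eq_bigr => i _.
    by rewrite scalerA exprS -addn1 PoszD addrK.
  by apply: cvgD; [exact: cvg_cst | exact: cvgZl_tmp].
- have -> : series (fun n => h ^- n.+1 *: c (Negz n - 1)) =
      (fun n => h *: series (fun n => h ^- n.+1 *: c (Negz n)) n.+1 - c (Negz 0)).
    apply/funext => n; rewrite /series /= big_nat_recl //= scalerDr scalerA.
    rewrite expr1 mulfV // scale1r [X in X - _]addrC addrK scaler_sumr.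
    apply: eq_bigr => i _; rewrite scalerA [in RHS]exprS invfM mulrA mulfV // mul1r.
    by congr (_ *: c _); rewrite !NegzE -[i.+2]addn1 PoszD opprD.
  apply: cvgB; last exact: cvg_cst.
  by apply: cvgZl_tmp; rewrite (cvg_shiftS (series _)).
- by rewrite scalerDr [X in _ = X + _]addrC addrACA subrr addr0.
Qed.

Lemma lsum_shiftU c h v : h != 0 -> lsum c h v -> lsum (fun k => c (k + 1)) h (h^-1 *: v).
Proof.
move=> h0 [a [b [ca cb ->]]].
exists (h^-1 *: (a - c 0)), (h^-1 *: (b + c 0)); split.
- have -> : series (fun n : nat => h ^+ n *: c (n%:Z + 1)) =
      (fun n => h^-1 *: (series (fun n => h ^+ n *: c n%:Z) n.+1 - c 0)).
    apply/funext => n; rewrite /series /= big_nat_recl //= expr0 scale1r.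
    rewrite addrAC subrr add0r scaler_sumr; apply: eq_bigr => i _.
    by rewrite scalerA exprS mulrA mulVf // mul1r -PoszD addn1.
  apply: cvgZl_tmp; apply: cvgB; last exact: cvg_cst.
  by rewrite (cvg_shiftS (series _)).
- rewrite -cvg_shiftS /=.
  have -> : (fun n => series (fun n : nat => h ^- n.+1 *: c (Negz n + 1)) n.+1) =
      (fun n => h^-1 *: (series (fun n => h ^- n.+1 *: c (Negz n)) n + c 0)).
    apply/funext => n; rewrite /series /= big_nat_recl //= expr1.
    rewrite scalerDr addrC; congr (_ + _); rewrite scaler_sumr; apply: eq_bigr => i _.
    rewrite scalerA -invfM -exprS; congr (_ *: c _).
    by rewrite !NegzE -[i.+2]addn1 PoszD opprD subrK.
  by apply: cvgZl_tmp; apply: cvgD => //; exact: cvg_cst.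
- by rewrite -scalerDr addrACA addNr addr0.
Qed.

Lemma lsum_shift c (P : set R[i]) (v : R[i] -> E) (k : int) :
  (forall h, P h -> h != 0) -> (forall h, P h -> lsum c h (v h)) ->
  forall h, P h -> lsum (fun j => c (j + k)) h (h ^ (- k) *: v h).
Proof.
move=> P0 cv h Ph; have h0 := P0 _ Ph.
case: k => n; last rewrite NegzE opprK.
- elim: n => [|n ih].
    rewrite oppr0 expr0z scale1r (_ : (fun _ => _) = c); first exact: cv.
    by apply/funext => j; rewrite addr0.
  have := lsum_shiftU h0 ih; rewrite scalerA -[h^-1]/(h ^ (-1)) -expfzDr // -opprD [1 + _]addrC.
  rewrite -PoszD addn1 (_ : (fun _ => _) = (fun j => c (j + n.+1%:Z))) //.
  by apply/funext => j; rewrite -addrA [1 + _]addrC -PoszD addn1.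
- elim: n => [|n ih]; first exact: lsum_shiftD (cv _ Ph).
  have := lsum_shiftD h0 ih.
  rewrite scalerA -exprSz.
  rewrite (_ : (fun _ => _) = (fun j => c (j - n.+2%:Z))) //.
  by apply/funext => j; rewrite -addrA -opprD -PoszD add1n.
Qed.

End laurent_series.

(** * Uniqueness of Laurent coefficients without contour integrals *)

Section laurent_uniqueness.
Context {R : realType} {E : normedModType R[i]}.
Implicit Types (c : int -> E) (h : R[i]) (v w : E).

Lemma exprn_small (q e M : R) : 0 <= q < 1 -> 0 < e ->
  exists N, forall n, (N <= n)%N -> M * q ^+ n <= e.
Proof.
move=> /andP[q0 q1] e0; have q1' : `|q| < 1 by rewrite ger0_norm.
have [N _ NP] := @cvgr0_norm_le _ _ _ _ _ _ (cvg_geometric M q1') _ e0.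
by exists N => n Nn; apply: le_trans (ler_norm _) (NP n Nn).
Qed.

(** The geometric bound [M q / (1 - q)] is at most [3 M q] because [q <= 2/3]. The partial sums
    satisfy the sharper bound [3 M q (1 - q^n)], which is what the induction carries. *)
Lemma series_geometric_le (t : nat -> E) (a : E) (M q : R) :
  0 <= M -> 0 <= q <= 2 / 3 -> series t @ \oo --> a ->
  (forall n, nrm (t n) <= M * q ^+ n.+1) -> nrm a <= 3 * M * q.
Proof.
move=> M0 /andP[q0 q23] ta tM; apply: (cvg_nrm_le ta) => n.
apply: le_trans (nrm_sum _ _) _.
suff : \sum_(0 <= k < n) nrm (t k) <= 3 * M * q * (1 - q ^+ n).
  move/le_trans; apply; have : 0 <= M * q * q ^+ n by rewrite !mulr_ge0 // exprn_ge0.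
  by rewrite mulrBr; lra.
elim: n => [|n ih]; first by rewrite big_geq // expr0 subrr mulr0.
rewrite big_nat_recr //=; have := tM n; rewrite exprS.
have : 0 <= M * q * q ^+ n by rewrite !mulr_ge0 // exprn_ge0.
move: (q ^+ n) ih => x ih; rewrite mulrA; set y := M * q * x => y0 tn.
have : y * (3 * q - 2) <= 0 by rewrite mulr_ge0_le0 //; lra.
have -> : 3 * M * q * (1 - q * x) = 3 * M * q * (1 - x) + 3 * y - 3 * y * q.
  by rewrite /y; ring.
by move: ih; move: (3 * M * q * (1 - x)) => z; lra.
Qed.

Lemma series_behead (t : nat -> E) (a : E) : series t @ \oo --> a ->
  series (fun n => t n.+1) @ \oo --> a - t 0%N.
Proof.
rewrite -cvg_shiftS /= => ta.
have -> : series (fun n => t n.+1) = (fun n => series t n.+1 - t 0%N).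
  by apply/funext => n; rewrite /series /= big_nat_recl //= addrAC subrr add0r.
by apply: cvgB => //; exact: cvg_cst.
Qed.

Lemma series_terms_bounded (t : nat -> E) (a : E) : series t @ \oo --> a ->
  exists M, 0 <= M /\ forall n, nrm (t n) <= M.
Proof.
move=> /cvg_nrm_bounded[M tM]; exists (M + M).
have M0 : 0 <= M by apply: le_trans (nrm_ge0 _) (tM 0).
split=> [|n]; first exact: addr_ge0.
have -> : t n = series t n.+1 - series t n.
  by rewrite /series /= big_nat_recr //= addrAC subrr add0r.
by rewrite (le_trans (nrmD _ _)) // nrmN lerD.
Qed.

Lemma normcX (x : R[i]) n : normc (x ^+ n) = normc x ^+ n.
Proof.
elim: n => [|n ih]; first by rewrite !expr0 ComplexField.Normc.normc1.
by rewrite !exprS ComplexField.Normc.normcM ih.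
Qed.

Lemma normc_real (x : R) : 0 <= x -> normc x%:C = x.
Proof. by move=> x0; apply: complexI; rewrite -Defs.normcE ger0_norm // ler0c. Qed.

Lemma lsum_nonneg_bounded c (r : R) v : 0 < r -> lsum c r%:C v ->
  exists M, 0 <= M /\ forall n : nat, r ^+ n * nrm (c n%:Z) <= M.
Proof.
move=> r0 [a [_ [/series_terms_bounded[M [M0 cM]] _ _]]]; exists M; split=> // n.
by have := cM n; rewrite nrmZ normcX normc_real // ltW.
Qed.

Lemma lsum_neg_bounded c (r : R) v : 0 < r -> lsum c r%:C v ->
  exists M, 0 <= M /\ forall n : nat, nrm (c (Negz n)) <= M * r ^+ n.+1.
Proof.
move=> r0 [_ [b [_ /series_terms_bounded[M [M0 cM]] _]]]; exists M; split=> // n.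
have := cM n; rewrite nrmZ ComplexField.Normc.normcV normcX (normc_real (ltW r0)).
by rewrite ler_pdivrMl ?exprn_gt0 // mulrC.
Qed.

(** Averaging the values at [h] and [-h] cancels the odd indices. This is the algebraic substitute
    for integrating over a circle. *)
Lemma lsum_even c h v w : lsum c h v -> lsum c (- h) w ->
  lsum (fun k => c (2 * k)) (h ^+ 2) (2^-1 *: (v + w)).
Proof.
have even_series (x y p : nat -> E) :
    (forall n, x n.*2 + y n.*2 + (x n.*2.+1 + y n.*2.+1) = 2 *: p n) ->
    series p = fun n => 2^-1 *: (series x n.*2 + series y n.*2).
  move=> xyp; apply/funext; elim=> [|n ih].
    by rewrite /series /= !big_geq // addr0 scaler0.
  rewrite /series /= in ih *; rewrite doubleS !big_nat_recr //= ih.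
  have -> : p n = 2^-1 *: (2 *: p n) by rewrite scalerA mulVf ?scale1r // pnatr_eq0.
  rewrite -xyp -scalerDr.
  congr (_ *: _); rewrite [RHS]addrACA [X in _ = X + _]addrACA. by rewrite -[RHS]addrA.
have double_cvg (u : nat -> E) l : u @ \oo --> l -> (fun n => u n.*2) @ \oo --> l.
  move=> ul; under eq_fun do rewrite -mul2n.
  exact: (cvg_comp _ _ (@cvg_mulnl 2 isT) ul).
have even_oppX n : (- h) ^+ n.*2 = h ^+ n.*2.
  by rewrite exprNn -signr_odd odd_double expr0 mul1r.
have odd_oppX n : (- h) ^+ n.*2.+1 = - h ^+ n.*2.+1.
  by rewrite !exprS even_oppX mulNr.
move=> [a1 [b1 [ca1 cb1 ->]]] [a2 [b2 [ca2 cb2 ->]]].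
exists (2^-1 *: (a1 + a2)), (2^-1 *: (b1 + b2)); split.
- rewrite (even_series (fun n => h ^+ n *: c n%:Z) (fun n => (- h) ^+ n *: c n%:Z)).
    by apply: cvgZl_tmp; apply: cvgD; exact: double_cvg.
  move=> n; rewrite even_oppX odd_oppX scaleNr subrr addr0 -mulr2n -scaler_nat.
  by rewrite -exprM -PoszM !mul2n.
- rewrite (even_series (fun n => h ^- n.+1 *: c (Negz n)) (fun n => (- h) ^- n.+1 *: c (Negz n))).
    by apply: cvgZl_tmp; apply: cvgD; exact: double_cvg.
  move=> n; rewrite -doubleS even_oppX odd_oppX invrN scaleNr subrr add0r -mulr2n -scaler_nat.
  have -> : 2 * Negz n = Negz n.*2.+1 by rewrite !NegzE mulrN -PoszM mul2n doubleS.
  by rewrite -exprM !mul2n.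
- by rewrite -scalerDr addrACA.
Qed.

(** Iterated even parts: both square roots of a point of the smaller punctured disc lie in the
    previous one. Only indices divisible by [2^j] survive, which isolates [c 0]. *)
Lemma lsum_dilate c (r : R) : 0 < r ->
  (forall h, 0 < normc h < r -> lsum c h 0) ->
  forall j h, 0 < normc h < r ^+ (2 ^ j) -> lsum (fun k => c ((2 ^ j)%N%:Z * k)) h 0.
Proof.
move=> r0 c0; elim=> [|j ih] w /andP[w0 wr].
  rewrite (_ : (fun _ => _) = c); last by apply/funext => k; rewrite expn0 mul1r.
  by apply: c0; rewrite w0 /=; rewrite expn0 expr1 in wr.
have wE := sqrtCK w; have sw : normc (sqrtC w) ^+ 2 = normc w by rewrite -normcX wE.
have s0 : 0 < normc (sqrtC w).
  rewrite lt_def normc_ge0 andbT; apply/negP => /eqP s0.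
  by move: w0; rewrite -sw s0 expr0n ltxx.
have sP : 0 < normc (sqrtC w) < r ^+ (2 ^ j).
  rewrite s0 -(ltr_pXn2r (ltn0Sn 1)) ?nnegrE ?normc_ge0 ?exprn_ge0 ?(ltW r0) //.
  by rewrite sw -exprM -expnSr.
have sN : 0 < normc (- sqrtC w) < r ^+ (2 ^ j) by rewrite normcN.
have := lsum_even (ih _ sP) (ih _ sN); rewrite addr0 scaler0 wE.
rewrite (_ : (fun _ => _) = (fun k => c ((2 ^ j.+1)%N%:Z * k))) //.
by apply/funext => k; rewrite mulrA expnSr PoszM.
Qed.

(** After enough dilations all indices except [0] are large in absolute value. The terms decay
    geometrically on the circle of radius [r / 2], so everything but [c 0] becomes negligible. *)
Lemma lsum_eq0_coef0 c (r : R) : 0 < r ->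
  (forall h, 0 < normc h < r -> lsum c h 0) -> c 0 = 0.
Proof.
move=> r0 cr; have lsum_real (x : R) : 0 < x < r -> lsum c x%:C 0.
  by move=> /andP[x0 xr]; apply: cr; rewrite normc_real ?x0 // ltW.
(* Convergence at [3r/4] controls the nonnegative indices and convergence at [r/3] the negative
   ones; relative to [r/2] both give the ratio [2/3]. *)
have r34 : 0 < r * (3 / 4) by rewrite mulr_gt0 //; lra.
have r13 : 0 < r / 3 by rewrite mulr_gt0 //; lra.
have R34 : 0 < r * (3 / 4) < r by rewrite r34 /=; lra.
have R13 : 0 < r / 3 < r by rewrite r13 /=; lra.
have [M1 [M10 cM1]] := lsum_nonneg_bounded r34 (lsum_real _ R34).
have [M2 [M20 cM2]] := lsum_neg_bounded r13 (lsum_real _ R13).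
pose M := M1 + M2; have M0 : 0 <= M by exact: addr_ge0.
have r2 : 0 < r / 2 by lra.
have posM n : (r / 2) ^+ n * nrm (c n%:Z) <= M * (2 / 3) ^+ n.
  have -> : r / 2 = (2 / 3) * (r * (3 / 4)) by lra.
  rewrite exprMn -mulrA mulrC ler_wpM2r ?exprn_ge0 ?divr_ge0 ?ler0n //.
  by apply: le_trans (cM1 n) _; rewrite lerDl.
have negM n : (r / 2) ^- n.+1 * nrm (c (Negz n)) <= M * (2 / 3) ^+ n.+1.
  rewrite ler_pdivrMl ?exprn_gt0 // mulrCA -exprMn.
  have -> : r / 2 * (2 / 3) = r / 3 by lra.
  by apply: le_trans (cM2 n) _; rewrite ler_wpM2r ?exprn_ge0 ?(ltW r13) // lerDr.
apply: nrm_eq0; apply/eqP; rewrite eq_le nrm_ge0 andbT; apply/ler_addgt0Pl => e e0.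
rewrite addr0; have [|N NP] := exprn_small (q := 2 / 3) (6 * M) _ e0; first lra.
set p := (2 ^ N)%N; have p0 : (0 < p)%N by rewrite expn_gt0.
have Np : (N <= p)%N by rewrite ltnW // ltn_expl.
apply: le_trans (NP _ Np).
set q := (2 / 3) ^+ p; have q0 : 0 <= q by rewrite exprn_ge0 //; lra.
have q23 : q <= 2 / 3.
  by rewrite -[leRHS]expr1 ler_wiXn2l //; lra.
have w0 : 0 < (r / 2) ^+ p by rewrite exprn_gt0.
(* At the point [(r/2)^p] the dilated term of index [k] is the original term of index [p k] at
   [r/2]. *)
have [|a [b [ca cb ab]]] := lsum_dilate r0 cr (j := N) (h := ((r / 2) ^+ p)%:C).
  rewrite normc_real ?(ltW w0) // w0 /=.
  by rewrite ltrXn2r -?lt0n //; lra.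
have aM : nrm (a - c 0) <= 3 * M * q.
  apply: (series_geometric_le M0 (t := fun n => ((r / 2) ^+ p)%:C ^+ n.+1 *: c (p%:Z * n.+1))).
  - by rewrite q0.
  - by have := series_behead ca; rewrite expr0 scale1r mulr0.
  - move=> n; rewrite nrmZ normcX normc_real ?(ltW w0) // -!exprM -PoszM.
    exact: posM.
have bM : nrm b <= 3 * M * q.
  apply: (series_geometric_le M0 _ cb); first by rewrite q0.
  move=> n; rewrite nrmZ ComplexField.Normc.normcV normcX (normc_real (ltW w0)).
  have -> : p%:Z * Negz n = Negz (p * n.+1).-1.
    by rewrite !NegzE prednK ?muln_gt0 ?p0 // PoszM mulrN.
  by rewrite -!exprM -{1 3}[(p * n.+1)%N]prednK ?muln_gt0 ?p0.
have -> : c 0 = - ((a - c 0) + b) by rewrite addrAC -ab add0r opprK.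
by rewrite nrmN (le_trans (nrmD _ _)) //; lra.
Qed.

Lemma lsum_eq0 c (r : R) : 0 < r ->
  (forall h, 0 < normc h < r -> lsum c h 0) -> forall k, c k = 0.
Proof.
move=> r0 cr k; rewrite -[k]add0r.
apply: (lsum_eq0_coef0 (c := fun j => c (j + k)) r0) => h hr.
have := lsum_shift (P := [set h | 0 < normc h < r]) (v := fun=> 0) k _ cr hr.
rewrite scaler0; apply=> z /andP[+ _].
by apply: contraTneq => ->; rewrite ComplexField.Normc.normc0 ltxx.
Qed.

(** The remainder after [c 0] is dominated by a geometric series of ratio [normc h / (r/2)], which
    is at most [2/3] when [normc h <= r/3]. *)
Lemma lsum_leading_coef c (r : R) (v : R[i] -> E) : 0 < r ->
  (forall h, 0 < normc h < r -> lsum c h (v h)) -> (forall n, c (Negz n) = 0) ->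
  exists M, 0 <= M /\ forall h, 0 < normc h <= r / 3 -> nrm (v h - c 0) <= M * normc h.
Proof.
move=> r0 cv cN; have r2 : 0 < r / 2 by rewrite mulr_gt0 //; lra.
have r2' : 0 < normc (r / 2)%:C < r by rewrite normc_real ?(ltW r2) // r2 /=; lra.
have [M [M0 cM]] := lsum_nonneg_bounded r2 (cv _ r2').
exists (3 * M / (r / 2)); split; first by rewrite !mulr_ge0 // invr_ge0 ltW.
move=> h /andP[h0 hr]; have [|a [b [ca cb ->]]] := cv h; first by rewrite h0 /=; lra.
have b0 : series (fun n => h ^- n.+1 *: c (Negz n)) @ \oo --> (0 : E).
  rewrite (_ : series _ = fun=> 0); first exact: cvg_cst.
  by apply/funext => n; rewrite /series /= big1 // => i _; rewrite cN scaler0.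
rewrite (cvg_unique (@norm_hausdorff _ _) cb b0) addr0.
have -> : 3 * M / (r / 2) * normc h = 3 * M * (normc h / (r / 2)) by rewrite mulrAC mulrA.
apply: (series_geometric_le M0 (t := fun n => h ^+ n.+1 *: c n.+1)).
- rewrite divr_ge0 ?(ltW h0) ?(ltW r2) //= ler_pdivrMr //; lra.
- by have := series_behead ca; rewrite expr0 scale1r.
- move=> n; rewrite nrmZ normcX expr_div_n mulrCA ler_wpM2l ?exprn_ge0 ?(ltW h0) //.
  by rewrite ler_pdivlMr ?exprn_gt0 // mulrC.
Qed.

End laurent_uniqueness.

(** * Powers of an operator with invertible [1 - z T] on a disc *)

Section disc_compactness.
Context {R : realType}.

Lemma normc_le_ReIm (a b : R) : normc (a +i* b) <= `|a| + `|b|.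
Proof.
have -> : a +i* b = a%:C + 0 +i* b by simpc.
rewrite (le_trans (normc_leD _ _)) // lerD //= expr0n /= ?addr0 ?add0r sqrtr_sqr //.
Qed.

Lemma normc_ge_ReIm (a b : R) : `|a| <= normc (a +i* b) /\ `|b| <= normc (a +i* b).
Proof.
by rewrite /= -!sqrtr_sqr !ler_sqrt ?addr_ge0 ?sqr_ge0 // lerDl lerDr !sqr_ge0.
Qed.

(** Compactness of the disc, phrased for a property [P M z] monotone in the bound [M]: local bounds
    yield one global bound. *)
Lemma disc_locally_bounded (r : R) (P : R -> R[i] -> Prop) :
  (forall M N z, M <= N -> P M z -> P N z) ->
  (forall z, normc z <= r -> exists eta M, 0 < eta /\
     forall w, normc (w - z) < eta -> normc w <= r -> P M w) ->
  exists M, forall z, normc z <= r -> P M z.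
Proof.
move=> Pmono Ploc.
(* Near a point outside the disc the condition is vacuous, so the local hypothesis extends to the
   compact square that contains the disc. *)
have Ploc' z : exists eta M, 0 < eta /\
    forall w, normc (w - z) < eta -> normc w <= r -> P M w.
  have [/Ploc//|zr] := leP (normc z) r.
  exists (normc z - r), 0; split=> [|w]; first by rewrite subr_gt0.
  move=> wz wr; exfalso; have := normc_dist w z; rewrite ler_norml => /andP[+ _]; lra.
have /compact_near_coveringP sq : compact (`[-r, r] `*` `[-r, r] : set (R * R)).
  by apply: compact_setX; exact: segment_compact.
(* The near-covering form of compactness, with the filter of large bounds [M] as parameter. *)
have := sq R (+oo)%R (fun M p => normc (p.1 +i* p.2) <= r -> P M (p.1 +i* p.2)) _ _.
case=> [[a b] _|M0 [_ /(_ (M0 + 1))]]; last first.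
  have M1 : M0 < M0 + 1 by rewrite ltrDl.
  move=> M0P; exists (M0 + 1) => -[a b] abr; apply: (M0P M1 (a, b)) => //=.
  have [ar br] := normc_ge_ReIm a b.
  by split; rewrite /= in_itv /= -ler_norml (le_trans _ abr).
have [eta [M [eta0 MP]]] := Ploc' (a +i* b).
exists ((fun p => is_true (normc ((p.1 - a) +i* (p.2 - b)) < eta)),
        (fun N => is_true (M <= N))); last first.
  by move=> [[x y] N] [/= xyab MN] xyr; apply: Pmono MN _; exact: MP.
split; last by apply: nbhs_pinfty_ge; exact: num_real.
have eta2 : 0 < eta / 2 by rewrite divr_gt0.
have pa : \forall p \near (a, b), `|a - p.1| < eta / 2.
  have fstc : (fst : R * R -> R) @ (a, b) --> a by exact: cvg_fst.
  by move/cvgrPdist_lt: fstc => /(_ _ eta2).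
have pb : \forall p \near (a, b), `|b - p.2| < eta / 2.
  have sndc : (snd : R * R -> R) @ (a, b) --> b by exact: cvg_snd.
  by move/cvgrPdist_lt: sndc => /(_ _ eta2).
apply: filterS2 pa pb => p pa pb /=.
by rewrite (le_lt_trans (normc_le_ReIm _ _)) // [eta]splitr ltrD // distrC.
Qed.

End disc_compactness.

(** * An elementary spectral radius estimate: decay of [d^n T^n] *)

Section rickart.
Context {R : realType} {E : normedModType R[i]}.
Variables (T : E -> E) (tau d : R).
Hypotheses (tau0 : 0 <= tau) (d0 : 0 < d).
Hypotheses (Tl : linear T) (Tb : forall f, nrm (T f) <= tau * nrm f).

Definition inverse_at (z : R[i]) (S : E -> E) : Prop :=
  [/\ linear S, forall f, S (f - z *: T f) = f & forall f, S f - z *: T (S f) = f].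

Hypothesis Tinv : forall z : R[i], normc z <= d -> exists S,
  inverse_at z S /\ exists c, forall f, nrm (S f) <= c * nrm f.

Lemma lin_iter n : linear (iter n T).
Proof. by elim: n => [|n ih] a u v //=; rewrite ih Tl. Qed.

Lemma nrm_iter n f : nrm (iter n T f) <= tau ^+ n * nrm f.
Proof.
elim: n => [|n ih] /=; first by rewrite mul1r.
by rewrite (le_trans (Tb _)) // exprS -mulrA ler_wpM2l.
Qed.

(** The resolvent identity for the inverses of [1 - z T] and [1 - w T]. *)
Lemma inverse_at_diff z w S S' f : inverse_at z S -> inverse_at w S' ->
  S' f - S f = (w - z) *: S (T (S' f)).
Proof.
move=> [Sl SL _] [_ _ SR]; have := SL (S' f).
have -> : S' f - z *: T (S' f) = f + (w - z) *: T (S' f).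
  rewrite scalerBl addrA; congr (_ - _).
  by rewrite -[LHS](subrK (w *: T (S' f))) SR.
by rewrite (linD Sl) (linZ Sl) => SE; rewrite -{1}SE addrAC subrr add0r.
Qed.

(** Each inverse is bounded with its own constant. The difference formula makes the bound locally
    uniform, and compactness of the disc makes it uniform. *)
Lemma inverse_at_bounded : exists C, 0 <= C /\ forall z, normc z <= d ->
  exists2 S, inverse_at z S & forall f, nrm (S f) <= C * nrm f.
Proof.
have [|z zd|C CP] := @disc_locally_bounded R d (fun M z =>
  exists2 S, inverse_at z S & forall f, nrm (S f) <= M * nrm f).
- move=> M N z MN [S Sz SM]; exists S => // f.
  by apply: le_trans (SM f) _; rewrite ler_wpM2r ?nrm_ge0.
- have [S [Sz [c Sc]]] := Tinv zd.
  pose b := `|c| + 1; have b0 : 0 < b by rewrite ltr_wpDl.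
  have Sb f : nrm (S f) <= b * nrm f.
    by apply: le_trans (Sc f) _; rewrite ler_wpM2r ?nrm_ge0 // ler_wpDr // ler_norm.
  (* Chosen so that [(w - z) S T S'] has norm at most half that of [S']; absorbing it gives the
     bound [2 b] for [S']. *)
  pose eta := (2 * b * (tau + 1))^-1; have t1 : 0 < tau + 1 by rewrite ltr_wpDl.
  exists eta, (2 * b); split; first by rewrite invr_gt0 !mulr_gt0.
  move=> w wz wd; have [S' [S'w _]] := Tinv wd; exists S' => // f.
  have -> : S' f = S f + (S' f - S f) by rewrite addrC subrK.
  rewrite (inverse_at_diff f Sz S'w).
  have : nrm ((w - z) *: S (T (S' f))) <= 2^-1 * nrm (S' f).
    rewrite nrmZ; have h1 := Sb (T (S' f)); have h2 := Tb (S' f).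
    have h3 : nrm (S (T (S' f))) <= b * ((tau + 1) * nrm (S' f)).
      apply: le_trans h1 _; rewrite ler_wpM2l ?(ltW b0) // (le_trans h2) //.
      by rewrite ler_wpM2r ?nrm_ge0 // lerDl.
    apply: le_trans (ler_pM (normc_ge0 _) (nrm_ge0 _) (ltW wz) h3) _.
    rewrite !mulrA ler_wpM2r ?nrm_ge0 // /eta !invfM.
    have -> : 2^-1 * b^-1 * (tau + 1)^-1 * b * (tau + 1) = 2^-1.
      by field; rewrite !gt_eqF.
    by [].
  have := nrmD (S f) (S' f - S f); rewrite (inverse_at_diff f Sz S'w).
  have -> : S f + (w - z) *: S (T (S' f)) = S' f.
    by rewrite -(inverse_at_diff f Sz S'w) addrC subrK.
  have := Sb f; lra.
- exists `|C|; split=> // z /CP[S Sz SC]; exists S => // f.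
  by apply: le_trans (SC f) _; rewrite ler_wpM2r ?nrm_ge0 // ler_norm.
Qed.

(* Averaging the inverses of [1 - z T] and [1 + z T] inverts [1 - z^2 T^2]; the
   bounds survive the averaging, so they are uniform in [k]. *)
Lemma inverse_power : exists C L, [/\ 0 <= C, 0 <= L &
  forall k, exists Q : R[i] -> E -> E, forall z, normc z <= d ->
    [/\ linear (Q z), forall f, Q z (f - z ^+ (2 ^ k) *: iter (2 ^ k) T f) = f,
        forall f, nrm (Q z f) <= C * nrm f &
        forall w f, normc w <= d -> nrm (Q w f - Q z f) <= L * normc (w - z) * nrm f]].
Proof.
have [C [C0 CP]] := inverse_at_bounded.
have /choice[S SP] z : exists S, normc z <= d ->
    inverse_at z S /\ forall f, nrm (S f) <= C * nrm f.
  by have [/CP[S Sz SC]|] := leP (normc z) d; [exists S | exists id].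
exists C, (C * tau * C); split=> //; first by rewrite !mulr_ge0.
elim=> [|k [Q QP]].
  exists S => z zd; have [Sz SC] := SP z zd; have [Sl SL SR] := Sz; split=> // w f wd.
  have [Sw SCw] := SP w wd; rewrite (inverse_at_diff f Sz Sw) nrmZ.
  rewrite [_ * normc _]mulrC -!mulrA ler_wpM2l ?normc_ge0 //.
  apply: le_trans (SC _) _; rewrite ler_wpM2l // (le_trans (Tb _)) // ler_wpM2l //.
set n := (2 ^ k)%N in QP *; have n0 : (0 < n)%N by rewrite expn_gt0.
(* Since [(om z)^n = - z^n] and [normc om = 1], the operator [Q (om z)] inverts [1 + z^n T^n] with
   the same bounds. *)
pose om : R[i] := n.-root (-1); have omn : om ^+ n = -1 by exact: rootCK.
have om1 : normc om = 1.
  apply/eqP; rewrite -(pexpr_eq1 n0) ?normc_ge0 // -normcX omn normcN.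
  by rewrite ComplexField.Normc.normc1.
have omd z : normc z <= d -> normc (om * z) <= d.
  by rewrite ComplexField.Normc.normcM om1 mul1r.
exists (fun z f => 2^-1 *: (Q z f + Q (om * z) f)) => z zd.
have [Ql QL QC QLip] := QP z zd; have [Ql' QL' QC' QLip'] := QP _ (omd _ zd).
have half : normc (2^-1 : R[i]) = 2^-1.
  by have -> : (2^-1 : R[i]) = (2^-1 : R)%:C; rewrite ?normc_real ?invr_ge0 // fmorphV rmorph_nat.
split.
- move=> a u v; rewrite Ql Ql' addrACA -scalerDr [LHS]scalerDr !scalerA.
  by rewrite mulrC.
- move=> f; set B := fun f => z ^+ n *: iter n T f.
  have Bl : linear B.
    by move=> a u v; rewrite /B lin_iter scalerDr !scalerA mulrC.
  have -> : z ^+ (2 ^ k.+1) *: iter (2 ^ k.+1) T f = B (B f).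
    rewrite /B (linZ (lin_iter n)) scalerA -exprD expnS mul2n -addnn iterD //.
  (* With [1 - B^2 = (1 - B)(1 + B)], each of the two inverses undoes one factor. *)
  have -> : Q z (f - B (B f)) = f + B f.
    by rewrite -[RHS]QL; congr (Q z _); rewrite -/(B _) (linD Bl) addrKA.
  have -> : Q (om * z) (f - B (B f)) = f - B f.
    rewrite -[RHS]QL'; congr (Q _ _); rewrite exprMn omn mulN1r scaleNr opprK.
    by rewrite -/(B _) (linB Bl) addrA subrK.
  have -> : f + B f + (f - B f) = 2 *: f by rewrite addrACA subrr addr0 scaler_nat mulr2n.
  by rewrite scalerA mulVf ?scale1r // pnatr_eq0.
- move=> f; rewrite nrmZ half ler_pdivrMl //; apply: le_trans (nrmD _ _) _.
  by have := QC f; have := QC' f; lra.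
- move=> w f wd; rewrite -scalerBr opprD addrACA nrmZ half ler_pdivrMl //.
  apply: le_trans (nrmD _ _) _; have := QLip w f wd; have := QLip' _ f (omd _ wd).
  by rewrite -mulrBr ComplexField.Normc.normcM om1 mul1r; lra.
Qed.

Definition power_le (r e : R) (k : nat) : Prop :=
  forall f, r ^+ (2 ^ k) * nrm (iter (2 ^ k) T f) <= e * nrm f.

(** Operator-norm convergence of [(r T)^n] to zero along [n = 2^k], the exponents reached by
    repeated averaging. *)
Definition powers_vanish (r : R) : Prop :=
  forall e, 0 < e -> exists N, forall k, (N <= k)%N -> power_le r e k.

Lemma powers_vanish0 : powers_vanish 0.
Proof.
move=> e e0; exists 0%N => k _ f; rewrite expr0n gtn_eqF ?expn_gt0 // mul0r.
by rewrite mulr_ge0 ?nrm_ge0 ?ltW.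
Qed.

Lemma powers_vanish_lt (r s : R) N : 0 <= r < s ->
  (forall k, (N <= k)%N -> power_le s 1 k) -> powers_vanish r.
Proof.
move=> /andP[r0 rs] sN e e0; have s0 : 0 < s by apply: le_lt_trans rs.
have q01 : 0 <= r / s < 1 by rewrite divr_ge0 ?(ltW s0) //= ltr_pdivrMr // mul1r.
have [N' NP] := exprn_small 1 q01 e0; exists (maxn N N') => k.
rewrite geq_max => /andP[Nk Nk'] f.
have -> : r ^+ (2 ^ k) = (r / s) ^+ (2 ^ k) * s ^+ (2 ^ k).
  by rewrite -exprMn divfK // gt_eqF.
have [q0 _] := andP q01; rewrite -mulrA; apply: ler_pM.
- exact: exprn_ge0.
- by rewrite mulr_ge0 ?nrm_ge0 ?exprn_ge0 ?(ltW s0).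
- by rewrite -[leLHS]mul1r NP // (leq_trans Nk') // ltnW // ltn_expl.
- by have := sN k Nk f; rewrite mul1r.
Qed.

(** Continuation in the radius from [0] to [d]: vanishing passes to limits from below and extends by
    a step of fixed length, so finitely many steps reach [d]. *)
Lemma powers_vanish_d : powers_vanish d.
Proof.
have [C [L [C0 L0 QP]]] := inverse_power.
have powE k (r : R) f : 0 <= r ->
    nrm (r%:C ^+ (2 ^ k) *: iter (2 ^ k) T f) = r ^+ (2 ^ k) * nrm (iter (2 ^ k) T f).
  by move=> r0; rewrite nrmZ normcX normc_real.
(* [1 - (r T)^n] is close to [1] exactly when its inverse is, and the inverse is
   Lipschitz in [r] uniformly in [n]. *)
have step (r s e : R) : 0 < e <= 1 / 2 -> 0 <= r <= s -> s <= d -> L * (s - r) <= e / 2 ->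
    powers_vanish r -> exists N, forall k, (N <= k)%N -> power_le s (2 * e) k.
  move=> /andP[e0 e12] /andP[r0 rs] sd Lrs rv.
  have [|N NP] := rv (e / 2 / (C + 1)).
    by rewrite !divr_gt0 // ltr_wpDl.
  exists N => k /NP kr f; have [Q Qk] := QP k.
  have s0 : 0 <= s by exact: le_trans rs.
  have rd : normc r%:C <= d by rewrite normc_real // (le_trans rs).
  have sd' : normc s%:C <= d by rewrite normc_real.
  have [Ql QL QC QLip] := Qk _ rd; have [Ql' QL' _ _] := Qk _ sd'.
  have Qr g : nrm (Q r%:C g - g) <= e / 2 * nrm g.
    rewrite -[X in _ - X](QL g) (linB Ql) opprB addrCA subrr addr0.
    apply: le_trans (QC _) _; rewrite powE //.
    apply: le_trans (ler_wpM2l C0 (kr g)) _; rewrite mulrA ler_wpM2r ?nrm_ge0 //.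
    rewrite mulrCA ler_piMr ?divr_ge0 ?(ltW e0) // ler_pdivrMr ?mul1r ?lerDl //.
    by rewrite ltr_wpDl.
  have Qs g : nrm (Q s%:C g - g) <= e * nrm g.
    have -> : Q s%:C g - g = (Q s%:C g - Q r%:C g) + (Q r%:C g - g) by rewrite addrA subrK.
    have := nrmD (Q s%:C g - Q r%:C g) (Q r%:C g - g); have := Qr g.
    have := QLip _ g sd'; rewrite -rmorphB normc_real ?subr_ge0 //.
    have : L * (s - r) * nrm g <= e / 2 * nrm g by rewrite ler_wpM2r ?nrm_ge0.
    by lra.
  (* As [Q] sends [f - b] to [f], the estimate bounds [b] by [e] times the norms of [f] and [b];
     [e <= 1/2] then absorbs [b], whence the factor [2 e]. *)
  rewrite -powE //; set b := s%:C ^+ _ *: _; have := Qs (f - b).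
  rewrite QL' subKr => fb; have := nrmD f (- b); rewrite nrmN => nfb.
  have : e * nrm (f - b) <= e * (nrm f + nrm b) by rewrite ler_wpM2l // ltW.
  have : e * nrm b <= 1 / 2 * nrm b by rewrite ler_wpM2r ?nrm_ge0.
  by rewrite mulrDr; lra.
have closed_step (s : R) : 0 < s <= d -> (forall r, 0 <= r < s -> powers_vanish r) ->
    powers_vanish s.
  move=> /andP[s0 sd] rv e e0; pose e' := Num.min (e / 2) (1 / 2).
  have e'0 : 0 < e' by rewrite lt_min !divr_gt0.
  have e'e : 2 * e' <= e.
    have : e' <= e / 2 by rewrite ge_min lexx.
    by lra.
  pose r := Num.max 0 (s - e' / 2 / (L + 1)).
  have L1 : 0 < L + 1 by rewrite ltr_wpDl.
  have el : 0 < e' / 2 / (L + 1) by rewrite !divr_gt0.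
  have rs : 0 <= r < s by rewrite le_max lexx /= gt_max s0 /=; lra.
  have [|||N NP] := step r s e' _ _ sd _ (rv _ rs).
  - by rewrite e'0 ge_min lexx orbT.
  - by case/andP: rs => -> /ltW ->.
  - have : s - r <= e' / 2 / (L + 1).
      by rewrite lerBlDr -lerBlDl le_max lexx orbT.
    move=> /(ler_wpM2l L0)/le_trans; apply; rewrite mulrCA ler_piMr ?divr_ge0 ?(ltW e'0) //.
    by rewrite ler_pdivrMr // mul1r lerDl.
  - by exists N => k Nk f; apply: le_trans (NP k Nk f) _; rewrite ler_wpM2r ?nrm_ge0.
(* With [e = 1/2] the powers at [s] are eventually at most [1]. This forces vanishing at every
   smaller radius, and then at [s] by the closed step. *)
have open_step (r s : R) : 0 <= r <= s -> s <= d -> L * (s - r) <= 1 / 4 ->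
    powers_vanish r -> powers_vanish s.
  move=> /andP[r0 rs] sd Lrs rv; have [s0|s0] := eqVneq s 0.
    by rewrite s0; exact: powers_vanish0.
  have s_gt0 : 0 < s by rewrite lt_def s0 (le_trans r0).
  apply: closed_step; first by rewrite s_gt0.
  have [|||N NP] := step r s (1 / 2) _ _ sd _ rv; [lra|by rewrite r0|lra|].
  move=> t ts; apply: (powers_vanish_lt (N := N) ts) => k /NP kP f.
  by apply: le_trans (kP f) _; rewrite ler_wpM2r ?nrm_ge0 //; lra.
have [st st0 Lst] : exists2 st : R, 0 < st & L * st <= 1 / 4.
  have L1 : 0 < L + 1 by rewrite ltr_wpDl.
  exists (4 * (L + 1))^-1; first by rewrite invr_gt0 mulr_gt0.
  by rewrite invfM mulrCA mul1r ler_piMr // ler_pdivrMr // mul1r lerDl.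
have all_steps n : powers_vanish (Num.min (st *+ n) d).
  elim: n => [|n ih]; first by rewrite mulr0n min_l ?(ltW d0) //; exact: powers_vanish0.
  apply: open_step ih; last first.
  - apply: le_trans _ Lst; rewrite ler_wpM2l // mulrSr.
    move: (st *+ n) => x.
    by rewrite /Num.min; case: ltP => h1; case: ltP => h2; lra.
  - by rewrite ge_min lexx orbT.
  - have : 0 <= st *+ n by rewrite mulrn_wge0 // ltW.
    rewrite mulrSr; move: (st *+ n) => x x0.
    by rewrite !le_min x0 (ltW d0) !ge_min lexx lerDl (ltW st0) !orbT.
have [n nP] : exists n, d <= st *+ n.
  exists (Num.truncn (d / st)).+1; rewrite -mulr_natr mulrC -ler_pdivrMr //.
  by rewrite ltW // truncnS_gt.
by have := all_steps n; rewrite min_r.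
Qed.

(** One exponent [n] with [d^n T^n] of norm at most [1/2] suffices: write [m = q n + s] and gain
    [2^-q], while the remainder [s < n] costs a fixed constant. *)
Lemma powers_cvg0 (e : R) : 0 < e ->
  exists N, forall n, (N <= n)%N -> forall f, d ^+ n * nrm (iter n T f) <= e * nrm f.
Proof.
move=> e0; have [|k0 /(_ _ (leqnn _))] := powers_vanish_d (e := 2^-1).
  by rewrite invr_gt0.
rewrite /power_le; set n := (2 ^ k0)%N => nP.
have n0 : (0 < n)%N by rewrite expn_gt0.
have dt0 : 0 <= d * tau by rewrite mulr_ge0 // ltW.
have [|N NP] := exprn_small (q := 2^-1) ((1 + d * tau) ^+ n) _ e0; first lra.
have qP q f : d ^+ (q * n) * nrm (iter (q * n) T f) <= 2^-1 ^+ q * nrm f.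
  elim: q f => [|q ih] f; first by rewrite mul0n !expr0.
  rewrite mulSn exprD iterD exprS -!mulrA mulrCA; apply: le_trans (ler_wpM2l _ (nP _)) _.
    by rewrite exprn_ge0 // ltW.
  by rewrite mulrCA ler_wpM2l // ih.
have sP s f : (s < n)%N -> d ^+ s * nrm (iter s T f) <= (1 + d * tau) ^+ n * nrm f.
  move=> sn; apply: le_trans (ler_wpM2l (exprn_ge0 s (ltW d0)) (nrm_iter s f)) _.
  rewrite mulrA -exprMn ler_wpM2r ?nrm_ge0 //.
  apply: (@le_trans _ _ ((1 + d * tau) ^+ s)).
    by rewrite lerXn2r ?nnegrE ?addr_ge0 // lerDr.
  by rewrite ler_weXn2l ?(ltnW sn) // lerDl.
exists (N * n)%N => m Nm f; rewrite (divn_eq m n) exprD iterD -mulrA mulrCA.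
apply: le_trans (ler_wpM2l _ (qP _ _)) _; first by rewrite exprn_ge0 // ltW.
rewrite mulrCA; apply: le_trans (ler_wpM2l _ (sP _ _ (ltn_pmod m n0))) _.
  by rewrite exprn_ge0 // invr_ge0.
rewrite mulrA ler_wpM2r ?nrm_ge0 // mulrC; apply: NP.
by rewrite leq_divRL.
Qed.

End rickart.

(** * Resolvents and their Laurent coefficients *)

Section bounded_operators.
Context {R : realType} {E : normedModType R[i]}.

Lemma bounded_operatorP (T : E -> E) : bounded_operator T ->
  linear T /\ exists2 c, 0 <= c & forall f, nrm (T f) <= c * nrm f.
Proof.
move=> [Tl [M MP]]; split=> //; exists `|complex.Re M|; first exact: normr_ge0.
move=> f; have := MP f; rewrite !nrmE lecE => /andP[_]; case: M MP => a b _ /=.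
rewrite mulr0 subr0 => /le_trans; apply.
by rewrite ler_wpM2r ?nrm_ge0 // ler_norm.
Qed.

End bounded_operators.

Section resolvents.
Context {R : realType} {E : normedModType R[i]}.
Variable A : operator E.
Implicit Types (f u v : E) (l m : R[i]).

Local Notation Res := (resolvent A).

Lemma domZ a u : dom A u -> dom A (a *: u).
Proof. by move=> du; rewrite -[_ *: _]addr0; exact: dom_lin du (dom0 A). Qed.

Lemma opD u v : dom A u -> dom A v -> A (u + v) = A u + A v.
Proof. by move=> du dv; rewrite -[u]scale1r op_lin // !scale1r. Qed.

Lemma op0 : A 0 = 0.
Proof.
have := opD (dom0 A) (dom0 A); rewrite addr0 => /eqP.
by rewrite -subr_eq0 opprD addrA subrr add0r oppr_eq0 => /eqP.
Qed.

Lemma opZ a u : dom A u -> A (a *: u) = a *: A u.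
Proof. by move=> du; rewrite -[a *: u]addr0 op_lin ?op0 ?addr0 //; exact: dom0. Qed.

Lemma resolventP l : resolvent_set A l -> is_resolvent A l (Res l).
Proof. exact: xgetPex. Qed.

Lemma resolvent_lin l : resolvent_set A l -> linear (Res l).
Proof. by case/resolventP => -[]. Qed.

Lemma resolvent_bounded l : resolvent_set A l ->
  exists2 c, 0 <= c & forall f, nrm (Res l f) <= c * nrm f.
Proof. by case/resolventP => /bounded_operatorP[]. Qed.

Lemma resolvent_dom l f : resolvent_set A l -> dom A (Res l f).
Proof. by case/resolventP => _ /(_ f)[]. Qed.

Lemma resolventK l f : resolvent_set A l -> l *: Res l f - A (Res l f) = f.
Proof. by case/resolventP => _ /(_ f)[]. Qed.

Lemma op_resolvent l f : resolvent_set A l -> A (Res l f) = l *: Res l f - f.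
Proof. by move=> rl; rewrite -[in X in _ - X](resolventK f rl) opprB addrC subrK. Qed.

Lemma Kresolvent l u : resolvent_set A l -> dom A u -> Res l (l *: u - A u) = u.
Proof. by case/resolventP => _ _; apply. Qed.

Lemma resolvent_eigenvector l a u : resolvent_set A l -> l != a -> dom A u ->
  A u = a *: u -> Res l u = (l - a)^-1 *: u.
Proof.
move=> rl la du Au; have := Kresolvent rl du.
rewrite Au -scalerBl (linZ (resolvent_lin rl)) => {2}<-.
by rewrite scalerA mulVf ?scale1r // subr_eq0.
Qed.

Lemma resolvent_identity l m f : resolvent_set A l -> resolvent_set A m ->
  Res l f = Res m f + (m - l) *: Res m (Res l f).
Proof.
move=> rl rm; rewrite -[LHS](Kresolvent rm (resolvent_dom f rl)).
rewrite (op_resolvent f rl) opprB addrCA -scalerBl.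
by rewrite (linD (resolvent_lin rm)) (linZ (resolvent_lin rm)).
Qed.

Lemma resolvent_comm l m f : resolvent_set A l -> resolvent_set A m ->
  Res l (Res m f) = Res m (Res l f).
Proof.
move=> rl rm; have [->//|lm] := eqVneq l m.
have ml : m - l != 0 by rewrite subr_eq0 eq_sym.
have D a b : resolvent_set A a -> resolvent_set A b ->
    (b - a) *: Res b (Res a f) = Res a f - Res b f.
  by move=> ra rb; rewrite {2}(resolvent_identity f ra rb) addrAC subrr add0r.
by apply: (scalerI ml); rewrite (D l m) // -(opprB l m) scaleNr (D m l) // opprB.
Qed.

End resolvents.

(** * Coefficient identities for the resolvent at [l0] *)

Section resolvent_laurent.
Context {R : realType} {E : normedModType R[i]}.
Variables (A : operator E) (l0 : R[i]) (U : int -> E -> E).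
Hypothesis UL : laurent_expansion (resolvent_set A) (resolvent A) l0 U.
Implicit Types (f u v : E).

Local Notation Res := (resolvent A).

Lemma coef_lin k : linear (U k).
Proof. by have [/(_ k)[]] := UL. Qed.

Lemma coef_bounded k : exists2 c, 0 <= c & forall f, nrm (U k f) <= c * nrm f.
Proof. by have [/(_ k)/bounded_operatorP[]] := UL. Qed.

Lemma opnorm_cvg_pt (a : nat -> R[i]) (V : nat -> E -> E) (G : E -> E) f :
  nrm f <= 1 -> opnorm_cvg (series (fun n => a n *: V n)) G ->
  series (fun n => a n *: V n f) @ \oo --> G f.
Proof.
move=> f1 VG; have f1' : [set f] `<=` [set f : E | `|f| <= 1].
  by move=> _ -> /=; rewrite nrmE lecR.
have -> : series (fun n => a n *: V n f) = (fun n => series (fun n => a n *: V n) n f).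
  by apply/funext => n; rewrite /series /= fct_sumE.
have := uniform_subset_cvg _ f1' VG; rewrite uniform_set1; apply; exact: fmap_filter.
Qed.

(** The operator limits [G] and [H] are controlled only on the unit ball, so a general [f] is
    normalised first and the resulting sum is scaled back. *)
Lemma resolvent_lsum : exists2 r : R, 0 < r & forall h, 0 < normc h < r ->
  resolvent_set A (l0 + h) /\ forall f, lsum (U^~ f) h (Res (l0 + h) f).
Proof.
have [_ /nbhs_ballP[e /= e0 eP]] := UL; move: e0; rewrite ltcE /= => /andP[/eqP ei er].
exists (complex.Re e) => // h /andP[h0 hr].
have [||rh [G [H [GP HP RE]]]] := eP (l0 + h).
- rewrite -ball_normE /= opprD addrA subrr add0r normrN Defs.normcE ltcE /= ei eqxx //.
- rewrite addrC -subr_eq0 addrK; apply: contraTneq h0 => ->.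
  by rewrite ComplexField.Normc.normc0 ltxx.
split=> // f; have small g : nrm g <= 1 -> lsum (U^~ g) h (Res (l0 + h) g).
  move=> g1; exists (G g), (H g); move: GP HP; rewrite addrAC subrr add0r => GP HP.
  split; [exact: opnorm_cvg_pt GP|exact: opnorm_cvg_pt HP|by rewrite RE].
have [->|f0] := eqVneq f 0; first by apply: small; rewrite nrm0.
have nf : 0 < nrm f by rewrite lt_def nrm_ge0 andbT; apply: contra_neq f0 => /nrm_eq0.
have fE : f = (nrm f)%:C *: ((nrm f)^-1%:C *: f).
  by rewrite scalerA -rmorphM mulfV ?gt_eqF // scale1r.
have lsum0 : lsum (fun=> 0) h (0 : E).
  by have := lsum_const h (0 : E); rewrite (_ : (fun _ => _) = fun=> 0) //;
    apply/funext => k; case: ifP.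
have := lsum_lincomb (nrm f)%:C (small ((nrm f)^-1%:C *: f) _) lsum0.
rewrite addr0 -(linZ (resolvent_lin rh)) -fE (_ : (fun _ => _) = U^~ f).
  by apply; rewrite nrmZ normc_real ?invr_ge0 ?nrm_ge0 // mulVf // gt_eqF.
by apply/funext => k; rewrite addr0 -(linZ (coef_lin k)) -fE.
Qed.

(** Resolvents commute, so both sides are coefficients of the same Laurent series in [h]. *)
Lemma coef_resolvent_comm m k f : resolvent_set A m -> U k (Res m f) = Res m (U k f).
Proof.
move=> rm; have [r r0 rP] := resolvent_lsum; have [c c0 cP] := resolvent_bounded rm.
apply/eqP; rewrite -subr_eq0 addrC -scaleN1r; apply/eqP.
apply: (lsum_eq0 r0 (c := fun k => -1 *: Res m (U k f) + U k (Res m f))) => h hr.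
have [rh hP] := rP h hr.
have := lsum_lincomb (-1) (lsum_lin (resolvent_lin rm) cP (hP f)) (hP (Res m f)).
by rewrite (resolvent_comm f rh rm) scaleN1r addNr.
Qed.

(* [A U_k = l0 U_k + U_(k-1) - [k = 0]] follows from comparing coefficients in the
   resolvent identity at a single [m] in the resolvent set. *)
Lemma coef_op k f : dom A (U k f) /\
  A (U k f) = l0 *: U k f + U (k - 1) f - (if k == 0 then f else 0).
Proof.
have [r r0 rP] := resolvent_lsum.
have r2 : 0 < normc (r / 2)%:C < r by rewrite normc_real; lra.
have [rm _] := rP _ r2; set m := l0 + _ in rm; pose del := m - l0.
have [c c0 cP] := resolvent_bounded rm.
(* The coefficients of [f + (m - l) R(l) f] for [l = l0 + h], as [m - l = del - h]. By the resolvent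
   identity [Res m] maps this vector to [R(l) f]. *)
pose g k := (if k == 0 then f else 0) + del *: U k f - U (k - 1) f.
have Ug j : U j f = Res m (g j).
  apply/eqP; rewrite -subr_eq0 addrC -scaleN1r; apply/eqP.
  apply: (lsum_eq0 r0 (c := fun j => -1 *: Res m (g j) + U j f)) => h hr.
  have [rh hP] := rP h hr; have h0 : h != 0.
    by case/andP: hr => + _; apply: contraTneq => ->; rewrite ComplexField.Normc.normc0 ltxx.
  have gP : lsum g h (f + (m - (l0 + h)) *: Res (l0 + h) f).
    have := lsum_lincomb (-1) (lsum_shiftD h0 (hP f))
      (lsum_lincomb del (hP f) (lsum_const h f)).
    rewrite (_ : (fun _ => _) = g); last first.
      by apply/funext => i; rewrite /g scaleN1r addrC [X in X - _]addrC.
    rewrite (_ : -1 *: _ + _ = f + (m - (l0 + h)) *: Res (l0 + h) f) //.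
    rewrite scaleN1r addrA addrC; congr (_ + _); rewrite -scaleNr -scalerDl.
    by congr (_ *: _); rewrite /del; ring.
  have := lsum_lincomb (-1) (lsum_lin (resolvent_lin rm) cP gP) (hP f).
  by rewrite (linD (resolvent_lin rm)) (linZ (resolvent_lin rm))
    -resolvent_identity // scaleN1r addNr.
split; first by rewrite Ug; exact: resolvent_dom.
have := op_resolvent (g k) rm; rewrite -Ug => ->; rewrite /g.
rewrite opprB addrCA opprD addrA [RHS]addrAC addrC.
rewrite (_ : m *: U k f = l0 *: U k f + del *: U k f); last by rewrite -scalerDl addrC subrK.
rewrite [X in _ + X]addrA addrACA addNr addr0 addrCA addrC.
by rewrite [- _ + _]addrC.
Qed.

Lemma coef_comm k u : dom A u -> U k (A u) = A (U k u).
Proof.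
have [r r0 rP] := resolvent_lsum.
have r2 : 0 < normc (r / 2)%:C < r by rewrite normc_real; lra.
have [rm _] := rP _ r2; set m := l0 + _ in rm => du.
have := coef_resolvent_comm k (m *: u - A u) rm; rewrite (Kresolvent rm du) => Uu.
have := op_resolvent (U k (m *: u - A u)) rm; rewrite -Uu => ->.
by rewrite (linB (coef_lin k)) (linZ (coef_lin k)) opprB addrCA subrr addr0.
Qed.

End resolvent_laurent.

Section laurent_coefficients.
Context {R : realType} {E : normedModType R[i]}.
Variables (A : operator E) (l0 : R[i]).
Implicit Types (f u v : E) (U V : int -> E -> E).

Local Notation Res := (resolvent A).
Local Notation laurent := (laurent_expansion (resolvent_set A) (resolvent A) l0).

Lemma laurent_unique U V k f : laurent U -> laurent V -> U k f = V k f.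
Proof.
move=> UL VL; have [r r0 rP] := resolvent_lsum UL; have [s s0 sP] := resolvent_lsum VL.
apply/eqP; rewrite -subr_eq0 addrC -scaleN1r; apply/eqP.
have rs0 : 0 < Num.min r s by rewrite lt_min r0.
apply: (lsum_eq0 rs0 (c := fun k => -1 *: V k f + U k f)) => h /andP[h0].
rewrite lt_min => /andP[hr hs].
have [|rh UP] := rP h; first by rewrite h0.
have [|_ VP] := sP h; first by rewrite h0.
by have := lsum_lincomb (-1) (VP f) (UP f); rewrite scaleN1r addNr.
Qed.

Variable U : int -> E -> E.
Hypothesis UL : laurent U.

(** Compare [U_k A u] with [A U_k u]. On an eigenvector [U_(-1)] is thus the identity and every
    other coefficient vanishes. *)
Lemma coef_eigenvector k u : dom A u -> A u = l0 *: u ->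
  U (k - 1) u = if k == 0 then u else 0.
Proof.
move=> du Au; have [_ Ak] := coef_op UL k u; have := coef_comm UL k du.
rewrite Au (linZ (coef_lin UL k)) Ak -addrA -[LHS]addr0 => /addrI/esym/eqP.
by rewrite subr_eq0 => /eqP.
Qed.

(** Away from index [0], [A - l0] lowers the index by one. It commutes with [U i], so one unit of
    index can be moved between the factors. *)
Lemma coef_comp (i j : int) f : i != 0 -> j + 1 != 0 -> U i (U j f) = U (i - 1) (U (j + 1) f).
Proof.
move=> i0 j0; set v := U (j + 1) f.
have [dv Av] := coef_op UL (j + 1) f; rewrite (negPf j0) subr0 addrK in Av.
have [di Ai] := coef_op UL i v; rewrite (negPf i0) subr0 in Ai.
have -> : U j f = A v - l0 *: v by rewrite Av addrC addKr.
rewrite (linB (coef_lin UL i)) (linZ (coef_lin UL i)) (coef_comm UL i dv) Ai.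
by rewrite addrC addKr.
Qed.

Lemma coef_comp_iter (i : int) (n : nat) f : i < 0 -> U i (U 0 f) = U (i - n%:Z) (U n%:Z f).
Proof.
move=> i0; elim: n => [|n ih]; first by rewrite subr0.
rewrite ih coef_comp.
- by rewrite -addrA -opprD -PoszD addn1.
- by rewrite lt_eqF // ltr_wnDr // oppr_le0.
- by rewrite -PoszD addn1.
Qed.

Hypothesis Ufin : exists m : nat, forall k : nat, (m < k)%N -> U (- k%:Z) = 0.

(** Index transfer pushes the outer index below [-m], where the coefficients vanish. *)
Lemma coef_neg_comp0 (i : int) f : i < 0 -> U i (U 0 f) = 0.
Proof.
move=> i0; have [m mP] := Ufin; rewrite (coef_comp_iter m _ i0).
case: i i0 => // n _; rewrite NegzE -opprD -PoszD mP //.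
by rewrite addSn ltnS leq_addl.
Qed.

(** Apply [U_(-1)] to [(A - l0) U_0 f = U_(-1) f - f]; the left side becomes [0] because
    [U_(-1) U_0 = 0]. *)
Lemma spectral_projection_idem f : U (-1) (U (-1) f) = U (-1) f.
Proof.
have [d0 A0] := coef_op UL 0 f; have := coef_comm UL (-1) d0.
have [_ ->] := coef_op UL (-1) (U 0 f).
rewrite -opprD coef_neg_comp0 // coef_neg_comp0 // subr0 addr0 scaler0 A0.
rewrite (linB (coef_lin UL _)) (linD (coef_lin UL _)) (linZ (coef_lin UL _)).
by rewrite coef_neg_comp0 // scaler0 sub0r add0r => /eqP; rewrite subr_eq0 => /eqP.
Qed.

Lemma leading_coef_cvg (m : nat) f : (forall k : nat, (m < k)%N -> U (- k%:Z) = 0) ->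
  exists M r : R, [/\ 0 <= M, 0 < r & forall h : R[i], 0 < normc h <= r ->
    resolvent_set A (l0 + h) /\
    nrm (h ^+ m *: Res (l0 + h) f - U (- m%:Z) f) <= M * normc h].
Proof.
move=> mP; have [r r0 rP] := resolvent_lsum UL.
have r3 : 0 < r / 3 by rewrite divr_gt0.
have hn0 (h : R[i]) : [set h | 0 < normc h < r] h -> h != 0.
  by move=> /andP[+ _]; apply: contraTneq => ->; rewrite ComplexField.Normc.normc0 ltxx.
have := lsum_shift (- m%:Z) hn0 (fun h hr => (rP h hr).2 f); rewrite opprK.
move/(lsum_leading_coef r0) => [n|M [M0 MP]].
  by rewrite NegzE -opprD -PoszD mP // addSn ltnS leq_addl.
exists M, (r / 3); split=> // h hr; split; last by have := MP h hr; rewrite add0r.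
by have [] := rP h; first by case/andP: hr => -> /=; lra.
Qed.

End laurent_coefficients.

(** * Neumann series and limits of resolvent powers *)

Section resolvent_powers.
Context {R : realType} {E : normedModType R[i]}.
Variables (A : operator E) (l : R[i]) (d : R).
Hypothesis (d0 : 0 < d).
Implicit Types (f u v : E).

Local Notation Res := (resolvent A).

(** Here [W] plays the part of [T (1 - z T)^-1]; for [T = R(l)] it is [R(l - z)], and the hypotheses
    are the resolvent identities. *)
Lemma inverse_at_id_add (T W : E -> E) z : linear T -> linear W ->
  (forall f, W f = T f + z *: T (W f)) -> (forall f, W f = T f + z *: W (T f)) ->
  inverse_at T z (fun f => f + z *: W f).
Proof.
move=> Tl Wl WT TW; split=> [a u v|f|f].
- by rewrite Wl scalerDr addrACA [in RHS]scalerDr !scalerA [z * a]mulrC.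
- rewrite (linB Wl) (linZ Wl) {1}(TW f) addrK.
  by rewrite -addrA addNr addr0.
- by rewrite (linD Tl) (linZ Tl) {1}(WT f) addrK.
Qed.

Lemma resolvent_neumann f : (forall z, normc z < d -> resolvent_set A (l - z)) ->
  forall t e : R, 0 < t < d -> 0 < e -> exists N, forall n, (N <= n)%N ->
    nrm (Res (l - t%:C) f - \sum_(0 <= k < n) t%:C ^+ k *: iter k.+1 (Res l) f) <= e.
Proof.
move=> rA t e /andP[t0 td] e0.
have rl : resolvent_set A l by rewrite -[l]subr0; apply: rA; rewrite ComplexField.Normc.normc0.
have rt : resolvent_set A (l - t%:C) by apply: rA; rewrite normc_real // ltW.
have [tau tau0 tauP] := resolvent_bounded rl.
(* The Neumann remainder is exactly [t^n R(l)^n g], which the decay of powers makes small. *)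
set g := Res (l - t%:C) f.
have gE n : g = \sum_(0 <= k < n) t%:C ^+ k *: iter k.+1 (Res l) f
                + t%:C ^+ n *: iter n (Res l) g.
  elim: n => [|n ih]; first by rewrite big_geq // add0r expr0 scale1r.
  rewrite {1}ih big_nat_recr //= -addrA; congr (_ + _).
  rewrite exprSr -scalerA -scalerDr; congr (_ *: _).
  rewrite {1}/g (resolvent_identity f rt rl) subKr.
  rewrite (linD (lin_iter (resolvent_lin rl) n)) (linZ (lin_iter (resolvent_lin rl) n)).
  by rewrite -!iterSr.
have [||N NP] := @powers_cvg0 _ _ (Res l) tau t tau0 t0 (resolvent_lin rl) tauP _ (e / (nrm g + 1)).
- move=> z zt; have rz : resolvent_set A (l - z) by apply: rA; apply: le_lt_trans td.
  have [c c0 cP] := resolvent_bounded rz.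
  have lz : l - (l - z) = z by rewrite subKr.
  exists (fun f => f + z *: Res (l - z) f); split.
    apply: inverse_at_id_add; [exact: resolvent_lin|exact: resolvent_lin|..] => u.
      by rewrite {1}(resolvent_identity u rz rl) lz.
    by rewrite {1}(resolvent_identity u rz rl) lz resolvent_comm.
  exists (1 + normc z * c) => u; rewrite mulrDl mul1r.
  apply: le_trans (nrmD _ _) _; rewrite lerD2l nrmZ -mulrA.
  by rewrite ler_wpM2l ?normc_ge0.
- by rewrite divr_gt0 // ltr_wpDl // nrm_ge0.
exists N => n /NP nP; rewrite {1}(gE n) addrC addKr nrmZ normcX normc_real ?(ltW t0) //.
apply: le_trans (nP g) _; rewrite -mulrA ler_piMr ?(ltW e0) // mulrC ler_pdivrMr.
  by rewrite mul1r lerDl.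
by rewrite ltr_wpDl // nrm_ge0.
Qed.

Variables (l0 : R[i]) (U : int -> E -> E).
Hypothesis UL : laurent_expansion (resolvent_set A) (resolvent A) l0 U.
Hypothesis Usimple : forall k f, (1 < k)%N -> U (- k%:Z) f = 0.
Hypothesis ll0 : l - d%:C = l0.
Hypothesis rA : forall z, normc z <= d -> z != d%:C -> resolvent_set A (l - z).

Local Notation P := (U (-1)).

Let Ufin : exists m : nat, forall k : nat, (m < k)%N -> U (- k%:Z) = 0.
Proof. by exists 1%N => k k1; apply/funext => f; exact: Usimple. Qed.

Let rl : resolvent_set A l.
Proof.
rewrite -[l]subr0; apply: rA; rewrite ?ComplexField.Normc.normc0 ?(ltW d0) //.
by rewrite eq_sym (inj_eq (@complexI R)) gt_eqF.
Qed.

Lemma simple_pole_eigen f : dom A (P f) /\ A (P f) = l0 *: P f.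
Proof.
have [dP ->] := coef_op UL (-1) f; split=> //.
by rewrite -opprD (Usimple (k := 2)) // addr0 subr0.
Qed.

(** The resolvent with its polar part at [l0] removed, so that [1 - z T] becomes invertible at
    [z = d] as well and the whole closed disc is available. *)
Definition reduced_resolvent f : E := Res l (f - P f).

Lemma reduced_resolvent_lin : linear reduced_resolvent.
Proof.
move=> a u v; rewrite /reduced_resolvent -(resolvent_lin rl); congr (Res l _).
by rewrite (coef_lin UL) opprD addrACA -scalerBr.
Qed.

Lemma reduced_resolvent_bounded :
  exists2 c, 0 <= c & forall f, nrm (reduced_resolvent f) <= c * nrm f.
Proof.
have [c c0 cP] := resolvent_bounded rl; have [b b0 bP] := coef_bounded UL (-1).
exists (c * (1 + b)); first by rewrite mulr_ge0 // addr_ge0.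
move=> f; apply: le_trans (cP _) _; rewrite -mulrA ler_wpM2l // mulrDl mul1r.
by rewrite (le_trans (nrmD _ _)) // nrmN lerD2l.
Qed.

(* On [ker P] the resolvent extends through [l0], with value [U 0] there. *)
Lemma reduced_resolvent_inverse z : normc z <= d ->
  exists S, inverse_at reduced_resolvent z S /\ exists c, forall f, nrm (S f) <= c * nrm f.
Proof.
move=> zd; have Pres m f : resolvent_set A m -> P (Res m (f - P f)) = 0.
  move=> rm; rewrite (coef_resolvent_comm UL) // (linB (coef_lin UL _)).
  by rewrite (spectral_projection_idem UL Ufin) subrr (lin0 (resolvent_lin rm)).
suff [W [Wl [c c0 cP] WT TW]] : exists W, [/\ linear W,
    exists2 c, 0 <= c & forall f, nrm (W f) <= c * nrm f,
    forall f, W f = reduced_resolvent f + z *: reduced_resolvent (W f)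
  & forall f, W f = reduced_resolvent f + z *: W (reduced_resolvent f)].
  exists (fun f => f + z *: W f); split.
    by apply: inverse_at_id_add => //; exact: reduced_resolvent_lin.
  exists (1 + normc z * c) => u; rewrite mulrDl mul1r.
  apply: le_trans (nrmD _ _) _; rewrite lerD2l nrmZ -mulrA.
  by rewrite ler_wpM2l ?normc_ge0.
rewrite /reduced_resolvent; have [->|zd'] := eqVneq z d%:C.
  (* Rewrite [(A - l0) U_0 f = P f - f] as [(l - A) U_0 f = f - P f + d U_0 f] and apply [Res l]. *)
  have U0E f : U 0 f = Res l (f - P f) + d%:C *: Res l (U 0 f).
    have [dU AU] := coef_op UL 0 f.
    rewrite -(linZ (resolvent_lin rl)) -(linD (resolvent_lin rl)).
    rewrite -[LHS](Kresolvent rl dU) AU; congr (Res l _).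
    have -> : d%:C = l - l0 by rewrite -ll0 subKr.
    rewrite eqxx sub0r scalerBl opprB addrCA -[RHS]addrA; congr (_ + _).
    by rewrite opprD addrA addrC.
  exists (U 0); split=> [||f|f]; [exact: coef_lin UL _|exact: coef_bounded UL _|..].
    by rewrite (coef_neg_comp0 UL Ufin) // subr0 -U0E.
  rewrite (coef_resolvent_comm UL) // (linB (coef_lin UL _)).
  have [dP AP] := simple_pole_eigen f.
  have := coef_eigenvector UL 1 dP AP; rewrite subrr => ->.
  by rewrite subr0 -U0E.
have rz : resolvent_set A (l - z) by exact: rA.
have lz : l - (l - z) = z by rewrite subKr.
have [c c0 cP] := resolvent_bounded rz; have [b b0 bP] := coef_bounded UL (-1).
have WE f : Res (l - z) (f - P f) = Res l (f - P f) + z *: Res l (Res (l - z) (f - P f)).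
  by rewrite {1}(resolvent_identity _ rz rl) lz.
exists (fun f => Res (l - z) (f - P f)); split=> [a u v||f|f].
- rewrite -(resolvent_lin rz); congr (Res _ _).
  by rewrite (coef_lin UL) opprD addrACA -scalerBr.
- exists (c * (1 + b)); first by rewrite mulr_ge0 // addr_ge0.
  move=> f; apply: le_trans (cP _) _; rewrite -mulrA ler_wpM2l // mulrDl mul1r.
  by rewrite (le_trans (nrmD _ _)) // nrmN lerD2l.
- by rewrite Pres // subr0 -WE.
- by rewrite Pres // subr0 resolvent_comm // -WE.
Qed.

(** Split [f = P f + g]. The scaled resolvent fixes [P f]; on [g] its powers are those of the
    reduced resolvent, since [P] keeps annihilating the iterates, and they tend to [0]. *)
Lemma resolvent_powers_cvg f (e : R) : 0 < e -> exists N, forall n, (N <= n)%N ->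
  nrm (d%:C ^+ n *: iter n (Res l) f - P f) <= e.
Proof.
move=> e0; have [c c0 cP] := reduced_resolvent_bounded; set g := f - P f.
have g1 : 0 < nrm g + 1 by rewrite ltr_wpDl // nrm_ge0.
have [|N NP] := powers_cvg0 c0 d0 reduced_resolvent_lin cP reduced_resolvent_inverse
  (e := e / (nrm g + 1)); first by rewrite divr_gt0.
have iterE n : iter n (Res l) g = iter n reduced_resolvent g /\ P (iter n (Res l) g) = 0.
  elim: n => [|n [ih Pih]] /=.
    by rewrite (linB (coef_lin UL _)) (spectral_projection_idem UL Ufin) subrr.
  rewrite -ih /reduced_resolvent Pih subr0 (coef_resolvent_comm UL) // Pih.
  by rewrite (lin0 (resolvent_lin rl)).
have [dP AP] := simple_pole_eigen f.
have iterP n : d%:C ^+ n *: iter n (Res l) (P f) = P f.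
  elim: n => [|n ih] /=; first by rewrite expr0 scale1r.
  rewrite exprS -scalerA -(linZ (resolvent_lin rl)) ih.
  have ld : l - l0 = d%:C by rewrite -ll0 subKr.
  have d0' : d%:C != 0 :> R[i] by rewrite (inj_eq (@complexI R)) gt_eqF.
  have ll0' : l != l0 by rewrite -subr_eq0 ld.
  have := resolvent_eigenvector rl ll0' dP AP; rewrite ld => ->.
  by rewrite scalerA mulfV ?scale1r.
exists N => n /NP nP; have fE : f = P f + g by rewrite addrC subrK.
rewrite {1}fE (linD (lin_iter (resolvent_lin rl) n)) scalerDr iterP.
rewrite addrAC subrr add0r nrmZ normcX normc_real ?(ltW d0) //.
rewrite (iterE n).1; apply: le_trans (nP g) _.
by rewrite -mulrA ler_piMr ?(ltW e0) // mulrC ler_pdivrMr // mul1r lerDl.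
Qed.

End resolvent_powers.

(** * Positivity in C(K) *)

Section continuous_functions.
Context {R : realType} {K : topologicalType} {cK : compact [set: K]}.
Local Notation E := (Cspace R cK).
Implicit Types (f g u : E).

Lemma nrm_ubound f x : normc (f x) <= nrm f.
Proof. exact: supnorm_ubound. Qed.

Definition Cconst (c : R[i]) : E := mkC cK (fun x => cvg_cst (c : R[i]^o)).

Lemma contractive_cts (phi : R[i] -> R[i]) f :
  (forall a b, normc (phi a - phi b) <= normc (a - b)) ->
  continuous (fun x => phi (f x) : R[i]^o).
Proof.
move=> phiP x; apply/cvgrPdist_le => e e0.
have /cvgrPdist_le /(_ _ e0) := @Ccts _ _ _ f x; apply: filterS => y.
by apply: le_trans; rewrite !Defs.normcE lecR.
Qed.

Lemma normc_Re_dist (a b : R[i]) :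
  normc ((complex.Re a)%:C - (complex.Re b)%:C) <= normc (a - b).
Proof.
case: a b => [a1 a2] [b1 b2]; rewrite -rmorphB /= expr0n addr0 sqrtr_sqr.
exact: (normc_ge_ReIm _ _).1.
Qed.

Lemma normc_Im_dist (a b : R[i]) :
  normc ((complex.Im a)%:C - (complex.Im b)%:C) <= normc (a - b).
Proof.
case: a b => [a1 a2] [b1 b2]; rewrite -rmorphB /= expr0n addr0 sqrtr_sqr.
exact: (normc_ge_ReIm _ _).2.
Qed.

Definition ReC f : E := mkC cK (@contractive_cts _ f normc_Re_dist).
Definition ImC f : E := mkC cK (@contractive_cts _ f normc_Im_dist).

Lemma ReCE f x : ReC f x = (complex.Re (f x))%:C. Proof. by []. Qed.
Lemma ImCE f x : ImC f x = (complex.Im (f x))%:C. Proof. by []. Qed.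

Lemma ReC_real f : real_valued (ReC f). Proof. by []. Qed.
Lemma ImC_real f : real_valued (ImC f). Proof. by []. Qed.

Lemma ReImC f : f = ReC f + 'i%C *: ImC f.
Proof. by apply/CspaceP => x; rewrite CaddE CscaleE ReCE ImCE -complexE. Qed.

Lemma realE f x : real_valued f -> f x = (complex.Re (f x))%:C.
Proof. by move=> /(_ x); case: (f x) => a b /= ->. Qed.

Lemma real_ReIm_inj f g u v : real_valued f -> real_valued g ->
  real_valued u -> real_valued v ->
  f + 'i%C *: g = u + 'i%C *: v -> f = u /\ g = v.
Proof.
move=> rf rg ru rv /CspaceP fguv; split; apply/CspaceP => x; have := fguv x;
  rewrite !CaddE !CscaleE (realE x rf) (realE x rg) (realE x ru) (realE x rv).
- by case=> + _; simpc => ->.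
- by case=> _; simpc => ->.
Qed.

Lemma nonneg_real f : nonneg f -> real_valued f.
Proof. by move=> f0 x; have := f0 x; rewrite lecE => /andP[/eqP]. Qed.

Lemma nonneg_Re f x : nonneg f -> 0 <= complex.Re (f x).
Proof. by move=> /(_ x); rewrite lecE => /andP[]. Qed.

Lemma real_nonneg f : real_valued f -> (forall x, 0 <= complex.Re (f x)) -> nonneg f.
Proof. by move=> rf f0 x; rewrite (realE x rf) ler0c. Qed.

Lemma nonneg0 : nonneg (0 : E). Proof. by move=> x; rewrite CzeroE. Qed.

Lemma nonnegD f g : nonneg f -> nonneg g -> nonneg (f + g).
Proof. by move=> f0 g0 x; rewrite CaddE addr_ge0. Qed.

Lemma nonnegZ (a : R) f : 0 <= a -> nonneg f -> nonneg (a%:C *: f).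
Proof. by move=> a0 f0 x; rewrite CscaleE mulr_ge0 // ler0c. Qed.

Lemma nonneg_sum (F : nat -> E) m n : (forall k, (m <= k)%N -> nonneg (F k)) ->
  nonneg (\sum_(m <= k < n) F k).
Proof.
move=> F0; rewrite big_nat_cond; elim/big_ind: _ => [|f g|k]; [exact: nonneg0|exact: nonnegD|].
by rewrite andbT => /andP[/F0].
Qed.

(** Nonnegativity in [R[i]] includes a vanishing imaginary part, so the real and imaginary parts are
    both passed to the limit. *)
Lemma nonneg_closed f :
  (forall e : R, 0 < e -> exists2 g, nonneg g & nrm (g - f) <= e) -> nonneg f.
Proof.
move=> fP; suff H x (e : R) : 0 < e -> `|complex.Im (f x)| <= e /\ - e <= complex.Re (f x).
  move=> x; rewrite lecE /=; apply/andP; split.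
    rewrite -normr_le0; apply/ler_addgt0Pl => e e0; rewrite addr0.
    by have [] := H x e e0.
  by apply/ler_addgt0Pl => e e0; rewrite -lerBlDl sub0r; have [] := H x e e0.
move=> e0; have [g g0 gf] := fP e e0; have := le_trans (nrm_ubound (g - f) x) gf.
have := g0 x; rewrite lecE CaddE (_ : (- f) x = - f x) //.
case: (g x) (f x) => [a b] [a' b'] /= /andP[/eqP -> a0].
have [ha hb] := normc_ge_ReIm (a - a') (0 - b').
rewrite -/(normc ((a - a') +i* (0 - b'))) => le_e; split.
  by have := le_trans hb le_e; rewrite sub0r normrN.
by have := le_trans ha le_e; rewrite ler_norml => /andP[_]; lra.
Qed.

(** Writes a real function as a difference of nonnegative ones, one of them constant. *)
Lemma real_nonneg_shift f : real_valued f -> nonneg (f + Cconst (nrm f)%:C).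
Proof.
move=> rf; apply: real_nonneg => x; first by rewrite CaddE (realE x rf) /= addr0.
rewrite CaddE /=; have := nrm_ubound f x; rewrite (realE x rf) /= expr0n addr0 sqrtr_sqr.
by rewrite ler_norml => /andP[]; lra.
Qed.

Lemma Cconst_nonneg (c : R) : 0 <= c -> nonneg (Cconst c%:C).
Proof. by move=> c0 x; rewrite ler0c. Qed.

Lemma lin_nonneg_eq0 (T : E -> E) : linear T -> (forall f, nonneg f -> T f = 0) ->
  forall f, T f = 0.
Proof.
move=> Tl T0; have Tr f : real_valued f -> T f = 0.
  move=> rf; rewrite -[f](addrK (Cconst (nrm f)%:C)) (linB Tl).
  rewrite !T0 ?subrr //; [exact: Cconst_nonneg (nrm_ge0 _) | exact: real_nonneg_shift].
move=> f; rewrite (ReImC f) (linD Tl) (linZ Tl) !Tr ?scaler0 ?addr0 //.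
Qed.

Lemma strongly_positive_nonneg f : strongly_positive f -> nonneg f.
Proof. by move=> [b b0 fb] x; rewrite (le_trans _ (fb x)) // ler0c ltW. Qed.

Lemma strongly_positiveZ (a : R) f : 0 < a -> strongly_positive f ->
  strongly_positive (a%:C *: f).
Proof.
move=> a0 [b b0 fb]; exists (a * b); first exact: mulr_gt0.
by move=> x; rewrite CscaleE rmorphM ler_wpM2l // ler0c ltW.
Qed.

(** A strongly positive function is an order unit; with lower bound [b] the factor [nrm f / b]
    works. *)
Lemma strongly_positive_dominates f g : strongly_positive g -> real_valued f ->
  exists2 c : R, 0 <= c & nonneg (c%:C *: g - f).
Proof.
move=> sg rf; have rg := nonneg_real (strongly_positive_nonneg sg).
case: sg => b b0 gb; exists (nrm f / b); first by rewrite divr_ge0 ?nrm_ge0 ?ltW.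
have E x : (((nrm f / b)%:C *: g - f) x) = (nrm f / b * complex.Re (g x) - complex.Re (f x))%:C.
  rewrite CaddE CscaleE (_ : (- f) x = - f x) // (realE x rg) (realE x rf) /=.
  by simpc.
move=> x; rewrite E ler0c subr_ge0.
have := nrm_ubound f x; rewrite (realE x rf) /= expr0n addr0 sqrtr_sqr.
move=> /(le_trans (ler_norm _))/le_trans; apply.
rewrite -mulrA ler_peMr ?nrm_ge0 // ler_pdivlMl // mulr1.
by have := gb x; rewrite lecE => /andP[].
Qed.

Lemma close_strongly_positive f g (b : R) : 0 < b -> real_valued g ->
  (forall x, b%:C <= f x) -> nrm (g - f) <= b / 2 -> strongly_positive g.
Proof.
move=> b0 rg fb gf; exists (b / 2) => [|x]; first by rewrite divr_gt0.
rewrite (realE x rg) lecR; have := fb x; rewrite lecE => /andP[_ /=].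
have := le_trans (nrm_ubound (g - f) x) gf.
rewrite CaddE (_ : (- f) x = - f x) //.
case: (g x) (f x) => [a a'] [c c'] /= le_e bc.
have [ha _] := normc_ge_ReIm (a - c) (a' - c').
by have := le_trans ha le_e; rewrite ler_norml => /andP[+ _]; lra.
Qed.

Lemma opp_nonneg_eq0 f : nonneg f -> nonneg (- f) -> f = 0.
Proof.
move=> f0 nf0; apply/CspaceP => x; rewrite CzeroE; apply/eqP; rewrite eq_le f0 andbT.
by have := nf0 x; rewrite (_ : (- f) x = - f x) // oppr_ge0.
Qed.

Lemma strongly_positive_neq0 f : [set: K] !=set0 -> strongly_positive f -> f <> 0.
Proof.
move=> [x _] [b b0 fb] f0; have := fb x; rewrite f0 CzeroE lecR leNgt.
by rewrite b0.
Qed.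

(** Writing the resolvent value as [x + i y], reality of [A] splits the equation and leaves
    [(l - A) y = 0], hence [y = 0]. *)
Lemma real_resolvent (A : operator E) (l : R) f : real_operator A ->
  resolvent_set A l%:C -> real_valued f -> real_valued (resolvent A l%:C f).
Proof.
move=> [Adom Aim] rl rf; set v := resolvent A l%:C f.
have dv : dom A v by exact: resolvent_dom.
rewrite (ReImC v) in dv; have [dx dy] := Adom _ _ (@ReC_real v) (@ImC_real v) dv.
have real_sub u : dom A u -> real_valued u -> real_valued (l%:C *: u - A u).
  move=> du ru x; rewrite CaddE CscaleE (_ : (- A u) x = - A u x) // (realE x ru).
  by rewrite (realE x (Aim u ru du)) /=; simpc.
have := resolventK f rl; rewrite -/v (ReImC v) opD ?opZ //; last exact: domZ.
rewrite scalerDr opprD addrACA scalerA mulrC -scalerA -scalerBr -[RHS]addr0.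
rewrite -[X in _ = f + X](scaler0 _ 'i%C).
case/real_ReIm_inj; [exact: real_sub|exact: real_sub|by []|by move=> x|].
move=> _ y0; have := Kresolvent rl dy; rewrite y0 (lin0 (resolvent_lin rl)) => <-.
by rewrite scaler0 addr0.
Qed.

End continuous_functions.

(** * Positivity of the leading coefficient and of the spectral projection *)

Section spectral_projection_positivity.
Context {R : realType} {K : topologicalType} {cK : compact [set: K]}.
Local Notation E := (Cspace R cK).
Variables (K0 : [set: K] !=set0) (A : operator E) (l0 : R) (U : int -> E -> E).
Hypothesis UL : laurent_expansion (resolvent_set A) (resolvent A) l0%:C U.
Implicit Types (f g u : E).

Local Notation Res := (resolvent A).
Local Notation P := (U (-1)).

Variable m : nat.
Hypotheses (m0 : (0 < m)%N) (Um : U (- m%:Z) <> 0).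
Hypothesis Ugt : forall k : nat, (m < k)%N -> U (- k%:Z) = 0.

Let Ufin : exists m : nat, forall k : nat, (m < k)%N -> U (- k%:Z) = 0.
Proof. by exists m. Qed.

Lemma leading_coef_eigen f : dom A (U (- m%:Z) f) /\ A (U (- m%:Z) f) = l0%:C *: U (- m%:Z) f.
Proof.
have [dU ->] := coef_op UL (- m%:Z) f; split=> //.
have -> : U (- m%:Z - 1) f = 0 by rewrite -opprD -PoszD Ugt // addn1.
by rewrite oppr_eq0 eqz_nat gtn_eqF // subr0 addr0.
Qed.

(** The correction [w] is bounded uniformly in [h], so the factor [h^m] removes it in the limit. It
    leaves room for the initial Neumann terms of unknown sign. *)
Lemma leading_coef_nonneg f :
  (exists C eta : R, 0 < eta /\ forall h : R, 0 < h < eta ->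
    exists2 w, nrm w <= C & nonneg (Res (l0%:C + h%:C) f + w)) ->
  nonneg (U (- m%:Z) f).
Proof.
move=> [C [eta [eta0 CP]]]; have [M [r [M0 r0 rP]]] := leading_coef_cvg UL f Ugt.
apply: nonneg_closed => e e0; pose D := M + `|C| + 1.
have D0 : 0 < D by rewrite ltr_wpDl // addr_ge0.
(* [h <= 1] gives [h^m <= h], so the two errors are at most [h M] and [h |C|], together at most
   [h D <= e]. *)
pose h := Num.min (Num.min r 1) (Num.min (eta / 2) (e / D)).
have h0 : 0 < h by rewrite !lt_min r0 ltr01 !divr_gt0.
have [hr h1] : h <= r /\ h <= 1 by split; rewrite !ge_min lexx ?orbT.
have [heta he] : h <= eta / 2 /\ h <= e / D by split; rewrite !ge_min lexx ?orbT.
have [|w wC wP] := CP h; first by rewrite h0 /=; lra.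
have [|_ hM] := rP h%:C; first by rewrite normc_real ?h0 // ltW.
exists (h%:C ^+ m *: (Res (l0%:C + h%:C) f + w)).
  by rewrite -rmorphXn /=; apply: nonnegZ => //; rewrite exprn_ge0 // ltW.
rewrite scalerDr addrAC; apply: le_trans (nrmD _ _) _.
rewrite normc_real ?(ltW h0) // in hM.
have hm : h ^+ m <= h by rewrite -[leRHS]expr1 ler_wiXn2l ?(ltW h0).
have : nrm (h%:C ^+ m *: w) <= h * `|C|.
  rewrite nrmZ normcX normc_real ?(ltW h0) //.
  by rewrite ler_pM ?exprn_ge0 ?nrm_ge0 ?(ltW h0) // (le_trans wC) // ler_norm.
rewrite ler_pdivlMr // /D in he; rewrite mulrDr mulr1 in he.
by move: he hM; rewrite mulrDr [h * M]mulrC; lra.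
Qed.

(** The common end of both converse implications. In the last hypothesis [g] will be a resolvent
    power applied to [f]; commutation with [P] yields the implication on kernels. *)
Lemma spectral_projection_strongly_positive :
  (forall f, nonneg f -> nonneg (U (- m%:Z) f)) ->
  (forall u, dom A u -> A u = l0%:C *: u -> positive u -> strongly_positive u) ->
  (forall f, positive f -> exists2 g, strongly_positive g & (P f = 0 -> P g = 0)) ->
  strongly_positive_operator P.
Proof.
move=> Upos eigen_pos dominate.
have [f f0 Uf] : exists2 f, nonneg f & U (- m%:Z) f <> 0.
  apply: contrapT => /forall2NP nU; apply: Um; apply/funext.
  apply: (lin_nonneg_eq0 (coef_lin UL _)) => f f0.
  by have [//|/contrapT] := nU f.
set u := U (- m%:Z) f in Uf; have [du Au] := leading_coef_eigen f.
have u_sp : strongly_positive u by apply: eigen_pos => //; split=> //; exact: Upos.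
(* If [m >= 2] then [U_(-m)] kills the eigenvector [u]. Since [f <= c u], positivity gives
   [U_(-m) f <= 0], contradicting the choice of [f]. *)
have m1 : m = 1%N.
  apply/eqP; rewrite eqn_leq m0 andbT leqNgt; apply/negP => m2.
  have Uu : U (- m%:Z) u = 0.
    have := coef_eigenvector UL (- m%:Z + 1) du Au; rewrite addrK => ->.
    case: eqP => // /eqP; rewrite addr_eq0 eqr_opp eqz_nat => /eqP m1.
    by rewrite m1 in m2.
  have [c c0 cuf] := strongly_positive_dominates u_sp (nonneg_real f0).
  have := Upos _ cuf; rewrite (linB (coef_lin UL _)) (linZ (coef_lin UL _)) Uu.
  by rewrite scaler0 sub0r => /(opp_nonneg_eq0 (Upos f f0)).
have Pu : P u = u by have := coef_eigenvector UL 0 du Au; rewrite sub0r eqxx.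
rewrite m1 in Upos.
move=> g [g0 gn0]; have [Pg0|Pg] := pselect (P g = 0); last first.
  by apply: eigen_pos; [| |split=> //; exact: Upos];
    have [] := leading_coef_eigen g; rewrite m1.
(* If [P g = 0] then also [P k = 0], and [u <= c k] gives [u = P u <= 0], which is impossible. *)
have [k k_sp kP] := dominate g (conj g0 gn0).
have [c c0 cku] := strongly_positive_dominates k_sp (nonneg_real (strongly_positive_nonneg u_sp)).
have := Upos _ cku; rewrite (linB (coef_lin UL _)) (linZ (coef_lin UL _)) (kP Pg0).
rewrite scaler0 sub0r Pu => /(opp_nonneg_eq0 (strongly_positive_nonneg u_sp)) u0.
by rewrite u0 in Uf.
Qed.

(* For real [u = P u] let [t = sup (u / P 1)]. Then [t P1 - u] is a fixed point of [P]
   that is nonnegative but not strongly positive, hence zero: [P] has rank one. *)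
Lemma strongly_positive_projection_rank1 : strongly_positive_operator P ->
  forall u, real_valued u -> P u = u -> exists t : R, u = t%:C *: P (Cconst 1).
Proof.
move=> Psp u ru Pu; set e := P (Cconst 1).
have one_pos : positive (Cconst 1 : E).
  split; first exact: (@Cconst_nonneg _ _ cK 1 ler01).
  by apply: (strongly_positive_neq0 K0); exists 1.
have e_sp := Psp _ one_pos; have re := nonneg_real (strongly_positive_nonneg e_sp).
have [b b0 eb] := e_sp.
have e0 x : 0 < complex.Re (e x).
  by apply: lt_le_trans b0 _; have := eb x; rewrite lecE => /andP[].
pose S := [set complex.Re (u x) / complex.Re (e x) | x in [set: K]].
have [c c0 cP] := strongly_positive_dominates e_sp ru.
have Re_comb (t : R) x : complex.Re ((t%:C *: e - u) x) = t * complex.Re (e x) - complex.Re (u x).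
  by rewrite CaddE CscaleE (_ : (- u) x = - u x) // (realE x re) (realE x ru) /=; simpc.
have Sub : has_sup S.
  split; first by case: K0 => x _; exists (complex.Re (u x) / complex.Re (e x)), x.
  exists c => _ [x _ <-]; rewrite ler_pdivrMr // -subr_ge0 -Re_comb.
  exact: nonneg_Re.
pose t := sup S; exists t.
have rt : real_valued (t%:C *: e - u).
  move=> x; rewrite CaddE CscaleE (_ : (- u) x = - u x) // (realE x re) (realE x ru) /=.
  by simpc.
have te : nonneg (t%:C *: e - u).
  apply: real_nonneg => // x; rewrite Re_comb subr_ge0 -ler_pdivrMr //.
  by apply: ub_le_sup; [case: Sub|exists x].
have [/eqP|teu] := pselect (t%:C *: e - u = 0).
  by rewrite subr_eq0 => /eqP.
(* A nonzero [t e - u] is fixed by [P], hence strongly positive, hence at least [e / d1]. Then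
   [u / e <= t - 1/d1] contradicts the choice of [t] as supremum. *)
have := Psp _ (conj te teu); rewrite (linB (coef_lin UL _)) (linZ (coef_lin UL _)) Pu.
rewrite {1}/e (spectral_projection_idem UL Ufin) -/e => sp.
have [d d0 dP] := strongly_positive_dominates sp re.
have [d1 d10 d1P] : exists2 d1 : R, 0 < d1 & nonneg (d1%:C *: (t%:C *: e - u) - e).
  exists (d + 1); first by rewrite ltr_wpDl.
  have -> : (d + 1)%:C *: (t%:C *: e - u) - e = (d%:C *: (t%:C *: e - u) - e) + (t%:C *: e - u).
    by rewrite rmorphD scalerDl scale1r addrAC.
  exact: nonnegD.
have : t <= t - d1^-1.
  apply: ge_sup; first by case: Sub.
  move=> _ [x _ <-]; rewrite ler_pdivrMr //.
  have := nonneg_Re x d1P; rewrite CaddE CscaleE (_ : (- e) x = - e x) //.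
  rewrite (realE x rt) (realE x re) Re_comb /=; simpc; rewrite subr_ge0.
  by rewrite -/e => /(fun H => etrans (ler_pdivrMl _ _ d10) H); rewrite mulrBl; lra.
by rewrite lerBrDl gerDr leNgt invr_gt0 d10.
Qed.

(** The range of [P] is the complex line through [e = P 1], which contains the given eigenvector.
    Hence [(A - l0) P = 0], that is [U_(-2) = 0], and the recursion kills the lower coefficients. *)
Lemma strongly_positive_projection_simple_pole :
  is_eigenvalue A l0%:C -> strongly_positive_operator P ->
  forall k f, (1 < k)%N -> U (- k%:Z) f = 0.
Proof.
move=> [v [dv vn0 Av]] Psp; set e := P (Cconst 1).
have Pv : P v = v by have := coef_eigenvector UL 0 dv Av; rewrite sub0r eqxx.
have P_nonneg f : nonneg f -> nonneg (P f).
  move=> f0; have [->|fn0] := pselect (f = 0).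
    by rewrite (lin0 (coef_lin UL _)); exact: nonneg0.
  by apply: strongly_positive_nonneg; exact: Psp.
have P_real f : real_valued f -> real_valued (P f).
  move=> rf; rewrite -[f](addrK (Cconst (nrm f)%:C)) (linB (coef_lin UL _)) => x.
  have r1 := nonneg_real (P_nonneg _ (real_nonneg_shift rf)).
  have r2 := nonneg_real (P_nonneg _ (@Cconst_nonneg _ _ cK _ (nrm_ge0 f))).
  by rewrite CaddE (_ : (- P _) x = - P (Cconst (nrm f)%:C) x) // (realE x r1) (realE x r2); simpc.
have rank1 u : P u = u -> exists t : R[i], u = t *: e.
  move=> Pu; have := Pu; rewrite (ReImC u) (linD (coef_lin UL _)) (linZ (coef_lin UL _)).
  case/real_ReIm_inj => [|||| PR PI]; do ?[exact: P_real|by []].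
  have [s sE] := strongly_positive_projection_rank1 Psp (@ReC_real _ _ _ u) PR.
  have [t tE] := strongly_positive_projection_rank1 Psp (@ImC_real _ _ _ u) PI.
  by exists (s%:C + 'i%C * t%:C); rewrite scalerDl -scalerA -tE -sE -ReImC.
have [s vE] := rank1 v Pv.
have s0 : s != 0 by apply: contra_notN vn0 => /eqP s0; rewrite vE s0 scale0r.
have eE : e = s^-1 *: v by rewrite vE scalerA mulVf // scale1r.
have P_eigen f : A (P f) = l0%:C *: P f.
  have [t ->] := rank1 _ (spectral_projection_idem UL Ufin f).
  have de : dom A e by rewrite eE; exact: domZ.
  have Ae : A e = l0%:C *: e by rewrite eE opZ // Av !scalerA mulrC.
  by rewrite opZ // Ae !scalerA mulrC.
have step k f : (0 < k)%N -> U (- k.+1%:Z) f = A (U (- k%:Z) f) - l0%:C *: U (- k%:Z) f.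
  move=> k0; have [_ ->] := coef_op UL (- k%:Z) f.
  rewrite oppr_eq0 eqz_nat gtn_eqF // subr0 -opprD -PoszD addn1.
  by rewrite addrAC subrr add0r.
elim=> [//|[//|[|k] ih]] f _; rewrite step //; first by rewrite P_eigen subrr.
by rewrite !ih // scaler0 op0 subrr.
Qed.

End spectral_projection_positivity.

Section spectral_bound_halfplane.
Context {R : realType} {E : normedModType R[i]}.

Lemma spectral_bound_resolvent (A : operator E) (l0 : R) (z : R[i]) :
  l0%:E = spectral_bound A -> l0 < complex.Re z -> resolvent_set A z.
Proof.
move=> sA zl0; apply: contrapT => nz; move: zl0; apply/negP; rewrite -leNgt -lee_fin sA.
by apply: ereal_sup_ubound; exists z.
Qed.

(** The disc touches its vertical tangent only at [d]. With [d = l - l0], the closed disc about [l]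
    therefore lies in the half-plane right of [l0] except for the point [l0]. *)
Lemma normc_le_Re_lt (d : R) (z : R[i]) : normc z <= d -> z != d%:C -> complex.Re z < d.
Proof.
case: z => a b zd zn; have [ha _] := normc_ge_ReIm a b.
have ad : a <= d by rewrite (le_trans (ler_norm a)) // (le_trans ha).
rewrite lt_neqAle ad andbT; apply: contra_neq zn => /= ad'.
have d0 : 0 <= d by rewrite (le_trans _ zd) // normc_ge0.
move: zd; rewrite /= -(ler_pXn2r (ltn0Sn 1)) ?nnegrE ?sqrtr_ge0 //.
rewrite sqr_sqrtr ?addr_ge0 ?sqr_ge0 // ad' gerDl => b0.
have /eqP : b ^+ 2 = 0 by apply/eqP; rewrite eq_le b0 sqr_ge0.
by rewrite sqrf_eq0 => /eqP ->.
Qed.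

End spectral_bound_halfplane.

Theorem theorem4p4 (R : realType) (K : topologicalType)
    (cK : compact [set: K]) (hK : hausdorff_space K) (K0 : [set: K] !=set0)
    (A : operator (Cspace R cK)) (l0 : R) (P : Cspace R cK -> Cspace R cK)
    (A_closed : closed_operator A) (A_dense : densely_defined A)
    (A_real : real_operator A)
    (l0_eigen : is_eigenvalue A l0%:C) (l0_pole : resolvent_pole A l0%:C)
    (P_proj : spectral_projection A l0%:C P) :
  (strongly_positive_operator P <-> indiv_eventually_strongly_positive A l0) /\
  (l0%:E = spectral_bound A ->
    (strongly_positive_operator P <->
      forall l : R, (spectral_bound A < l%:E)%E ->
        powers_eventually_strongly_positive A l) /\
    (strongly_positive_operator P <->
      exists l : R, (spectral_bound A < l%:E)%E /\
        powers_eventually_strongly_positive A l)).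
Proof.
have [U [UL [m [m0 Um Ugt]]]] := l0_pole.
(* The pole and the residue come with separate expansions; uniqueness of the coefficients identifies
   them. *)
have {P_proj} -> : P = U (-1).
  have [_ [V [VL <-]]] := P_proj; apply/funext => f; exact: laurent_unique VL UL.
have simple : strongly_positive_operator (U (-1)) ->
    forall k f, (1 < k)%N -> U (- k%:Z) f = 0.
  exact: (strongly_positive_projection_simple_pole K0 UL Ugt).
have l0D (l : R) : l0%:C + (l - l0)%:C = l%:C by rewrite -rmorphD addrC subrK.
have eigen_res (l : R) u : l0 < l -> resolvent_set A l%:C -> dom A u -> A u = l0%:C *: u ->
    resolvent A l%:C u = ((l - l0)^-1)%:C *: u.
  move=> ll rl du Au; rewrite (resolvent_eigenvector rl _ du Au) ?fmorphV ?rmorphB //.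
  by rewrite (inj_eq (@complexI R)) gt_eqF.
have i_ii : strongly_positive_operator (U (-1)) -> indiv_eventually_strongly_positive A l0.
  move=> Psp; have U1 k : (1 < k)%N -> U (- k%:Z) = 0.
    by move=> k1; apply/funext => f; exact: simple.
  (* The vector [0] serves only to obtain a punctured disc in the resolvent set whose radius does
     not depend on [f]. *)
  have [M [r [_ r0 rP]]] := leading_coef_cvg UL 0 U1.
  have rA (l : R) : l0 < l <= l0 + r -> resolvent_set A l%:C.
    move=> /andP[l0l lr]; rewrite -(l0D l); have [|//] := rP (l - l0)%:C.
    by rewrite normc_real; lra.
  exists (l0 + r); first by rewrite ltrDl.
  split=> // f [f0 fn0]; have [b b0 Pf] := Psp f (conj f0 fn0).
  have [M' [r' [M'0 r'0 r'P]]] := leading_coef_cvg UL f U1.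
  (* The last bound keeps the error [M' (l - l0)] below [b / 2], half the lower bound of [P f]. *)
  pose eta := Num.min (Num.min r r') (b / 2 / (M' + 1)).
  have M'1 : 0 < M' + 1 by rewrite ltr_wpDl.
  have eta0 : 0 < eta by rewrite !lt_min r0 r'0 !divr_gt0.
  have [etar etar' etab] : [/\ eta <= r, eta <= r' & eta <= b / 2 / (M' + 1)].
    by split; rewrite !ge_min lexx ?orbT.
  exists (l0 + eta); first by rewrite ltrDl eta0 lerD2l.
  move=> l /andP[l0l leta]; have h0 : 0 < l - l0 by rewrite subr_gt0.
  have rl : resolvent_set A l%:C by apply: rA; lra.
  have [|_] := r'P (l - l0)%:C; first by rewrite normc_real ?(ltW h0) // h0 /=; lra.
  rewrite l0D expr1 normc_real ?(ltW h0) // => close.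
  have real_f : real_valued (resolvent A l%:C f).
    by apply: real_resolvent => //; exact: nonneg_real.
  have : strongly_positive ((l - l0)%:C *: resolvent A l%:C f).
    apply: close_strongly_positive b0 _ Pf _.
      by move=> x; rewrite CscaleE (realE x real_f) /=; simpc.
    apply: le_trans close _; have : (l - l0) * (M' + 1) <= b / 2.
      by rewrite -ler_pdivlMr //; lra.
    by rewrite mulrDr mulr1 mulrC; lra.
  move/(strongly_positiveZ (a := (l - l0)^-1)); rewrite invr_gt0 h0 scalerA -rmorphM.
  by rewrite mulVf ?gt_eqF // scale1r; apply.
have ii_i : indiv_eventually_strongly_positive A l0 -> strongly_positive_operator (U (-1)).
  move=> [l2 l02 [rA fP]]; apply: (spectral_projection_strongly_positive UL m0 Um Ugt).
  - move=> f f0; have [->|fn0] := pselect (f = 0).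
      by rewrite (lin0 (coef_lin UL _)); exact: nonneg0.
    have [l1 /andP[l01 l12] l1P] := fP f (conj f0 fn0).
    apply: (leading_coef_nonneg UL m0 Ugt); exists 0, (l1 - l0).
    split=> [|h /andP[h0 hl]]; first by rewrite subr_gt0.
    exists 0; rewrite ?nrm0 // addr0 -rmorphD; apply: strongly_positive_nonneg.
    by apply: l1P; lra.
  - move=> u du Au u0; have [l1 /andP[l01 l12] /(_ l1)] := fP u u0.
    rewrite l01 lexx eigen_res //; last by apply: rA; rewrite l01.
    have d0 : 0 < l1 - l0 by rewrite subr_gt0.
    move=> /(_ isT)/(strongly_positiveZ d0); rewrite scalerA -rmorphM mulfV ?scale1r //.
    by rewrite gt_eqF.
  - move=> f f0; have [l1 /andP[l01 l12] /(_ l1)] := fP f f0.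
    rewrite l01 lexx => /(_ isT) sp; exists (resolvent A l1%:C f) => // Pf.
    have rl1 : resolvent_set A l1%:C by apply: rA; rewrite l01.
    by rewrite (coef_resolvent_comm UL) // Pf (lin0 (resolvent_lin rl1)).
split; first by split.
move=> sA; have rA z : l0 < complex.Re z -> resolvent_set A z.
  exact: spectral_bound_resolvent.
have i_iii : strongly_positive_operator (U (-1)) -> forall l : R,
    (spectral_bound A < l%:E)%E -> powers_eventually_strongly_positive A l.
  move=> Psp l; rewrite -sA lte_fin => l0l f [f0 fn0].
  have d0 : 0 < l - l0 by rewrite subr_gt0.
  have [b b0 Pf] := Psp f (conj f0 fn0).
  have ll : l%:C - (l - l0)%:C = l0%:C by rewrite -rmorphB subKr.
  have rAz (z : R[i]) : normc z <= l - l0 -> z != (l - l0)%:C -> resolvent_set A (l%:C - z).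
    move=> zd zn; apply: rA; have := normc_le_Re_lt zd zn.
    by case: z {zd zn} => x y /=; lra.
  have [|N NP] := resolvent_powers_cvg d0 UL (simple Psp) ll rAz f (e := b / 2).
    by rewrite divr_gt0.
  have rl : resolvent_set A l%:C by exact: rA.
  exists N => n /NP nP; set g := iter n _ f.
  have rg : real_valued g.
    rewrite /g; elim: (n) => [|i ih] /=; first exact: nonneg_real.
    exact: real_resolvent.
  have : strongly_positive ((l - l0)%:C ^+ n *: g).
    apply: close_strongly_positive b0 _ Pf nP.
    by move=> x; rewrite CscaleE (realE x rg) -rmorphXn /=; simpc.
  have dn : 0 < ((l - l0) ^+ n)^-1 by rewrite invr_gt0 exprn_gt0.
  move/(strongly_positiveZ dn); rewrite scalerA -rmorphXn -rmorphM mulVf ?scale1r //.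
  by rewrite gt_eqF // exprn_gt0.
have iv_i : (exists l : R, (spectral_bound A < l%:E)%E /\
    powers_eventually_strongly_positive A l) -> strongly_positive_operator (U (-1)).
  move=> [l []]; rewrite -sA lte_fin => l0l lP.
  have d0 : 0 < l - l0 by rewrite subr_gt0.
  have rl : resolvent_set A l%:C by exact: rA.
  apply: (spectral_projection_strongly_positive UL m0 Um Ugt).
  - move=> f f0; have [->|fn0] := pselect (f = 0).
      by rewrite (lin0 (coef_lin UL _)); exact: nonneg0.
    have [n0 n0P] := lP f (conj f0 fn0).
    apply: (leading_coef_nonneg UL m0 Ugt).
    (* The correction removes the first [n0] Neumann terms; this bounds it for all [h] at once
       because [0 <= t <= l - l0]. *)
    exists (\sum_(0 <= k < n0) (l - l0) ^+ k * nrm (iter k.+1 (resolvent A l%:C) f)), (l - l0).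
    split=> // h /andP[h0 hd]; pose t := l - l0 - h.
    have t0 : 0 < t < l - l0 by rewrite /t; lra.
    have t00 : 0 <= t by lra.
    pose F k := t%:C ^+ k *: iter k.+1 (resolvent A l%:C) f.
    exists (- \sum_(0 <= k < n0) F k).
      rewrite nrmN (le_trans (nrm_sum _ _)) //; apply: ler_sum => k _.
      rewrite nrmZ normcX normc_real // ler_wpM2r ?nrm_ge0 // lerXn2r ?nnegrE ?(ltW d0) //.
      by rewrite /t; lra.
    have -> : l0%:C + h%:C = l%:C - t%:C by rewrite -rmorphB -rmorphD; congr _%:C; rewrite /t; ring.
    apply: nonneg_closed => e e0.
    have rAz (z : R[i]) : normc z < l - l0 -> resolvent_set A (l%:C - z).
      case: z => x y zd; apply: rA => /=; have [+ _] := normc_ge_ReIm x y.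
      by move=> /le_lt_trans/(_ zd); rewrite ltr_norml => /andP[_]; lra.
    have [N NP] := resolvent_neumann d0 f rAz t0 e0.
    (* From index [n0] on every Neumann term is nonnegative, so the truncated tails approximate the
       corrected resolvent from within the cone. *)
    exists (\sum_(n0 <= k < maxn n0 N) F k).
      apply: nonneg_sum => k /(leq_trans (leqnn n0)) kn0; rewrite /F -rmorphXn.
      apply: nonnegZ; first exact: exprn_ge0.
      by apply: strongly_positive_nonneg; apply: n0P; exact: leqW.
    rewrite nrm_distC; have := NP (maxn n0 N) (leq_maxr _ _).
    by rewrite (big_cat_nat _ (n := n0)) ?leq_maxl //= opprD addrA.
  - move=> u du Au u0; have [n0 /(_ n0 (leqnn _))] := lP u u0.
    (* On an eigenvector resolvent powers are positive multiples of the identity, so strong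
       positivity returns to [u] itself. *)
    have -> : iter n0 (resolvent A l%:C) u = ((l - l0)^-1 ^+ n0)%:C *: u.
      elim: n0 => [|i ih] /=; first by rewrite expr0 scale1r.
      by rewrite ih (linZ (resolvent_lin rl)) eigen_res // scalerA -rmorphM exprSr.
    have dn : 0 < (l - l0) ^+ n0 by rewrite exprn_gt0.
    move/(strongly_positiveZ dn); rewrite scalerA -rmorphM -exprMn mulfV ?gt_eqF //.
    by rewrite expr1n scale1r.
  - move=> f f0; have [n0 /(_ n0 (leqnn _)) sp] := lP f f0.
    exists (iter n0 (resolvent A l%:C) f) => // Pf; elim: (n0) => [//|i ih] /=.
    by rewrite (coef_resolvent_comm UL) // ih (lin0 (resolvent_lin rl)).
split; split=> //.
- move=> iii; apply: iv_i; exists (l0 + 1); split; last apply: iii.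
    by rewrite -sA lte_fin ltrDl.
  by rewrite -sA lte_fin ltrDl.
- move=> Psp; exists (l0 + 1); split; last apply: i_iii => //.
    by rewrite -sA lte_fin ltrDl.
  by rewrite -sA lte_fin ltrDl.
Qed.
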